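(* Suppose Assumptions (A1), (A2), (A3), (A4) with $p=1$, and (A5) hold. There is a universal constant $c_2>0$ such that for any stepsize $\alpha>0$ with $\alpha\tau_\alpha L^2<c_2\mu$, the Markov chain $(x_k,\theta_k)_{k\ge0}$ of the unprojected iteration ($\beta=\infty$) is $V$-uniformly ergodic with Lyapunov function $V(x,\theta)=\|\theta-\theta^*\|^2+1$ and has a unique stationary distribution $\bar\nu_\alpha\in\mathcal P_2(\mathcal X\times\mathbb R^d)$. Moreover, there are constants $\rho\in(0,1)$ and $\kappa\in(0,\infty)$ (possibly depending on $\alpha$) such that $$\|\mathcal L(x_k,\theta_k)-\bar\nu_\alpha\|_V\le\kappa\rho^k\qquad\text{for all }(x_0,\theta_0)\in\mathcal X\times\mathbb R^d,\ k\ge0,$$ where $\|\nu\|_V:=\int|\nu(\mathrm d z)|V(z)$.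
   Context: Setting: $\mathcal X$ is a Borel space and $(x_k)_{k\ge0}$ is a Markov chain on $\mathcal X$ with transition kernel $P$ and stationary distribution $\pi$. For stepsize $\alpha>0$, deterministic $g:\mathbb R^d\times\mathcal X\to\mathbb R^d$ and i.i.d. random fields $\xi_k:\mathbb R^d\to\mathbb R^d$ ($k\ge1$), the unprojected SA is $\theta_{k+1}=\theta_k+\alpha(g(\theta_k,x_k)+\xi_{k+1}(\theta_k))$. $\mathcal F_k$ is the $\sigma$-algebra generated by $\{x_t,\theta_t,\xi_{t+1}\}_{t=0}^{k-1}\cup\{x_k,\theta_k\}$; $\bar g(\theta):=\mathbb E_{x\sim\pi}[g(\theta,x)]$. (A1) There exist $r\in[0,1)$, $R>0$ with $\sup_{x}\|P^k(x,\cdot)-\pi\|_{TV}\le Rr^k$; $\tau_\epsilon=\min\{k\ge1:\sup_x\|P^k(x,\cdot)-\pi\|_{TV}\le\epsilon\}$, $\tau_\alpha$ with $\epsilon=\alpha$. (A2) For each $x$, $g(\cdot,x)$ is $C^3$ with first to third derivatives bounded uniformly in $\theta$; there is $L_1>0$ with $\|g^{(i)}(\theta,x)-g^{(i)}(\theta',x)\|\le L_1\|\theta-\theta'\|$ for $i=0,1,2$, $\|g(0,x)\|\le L_1$, and $\|g(\theta,x)\|\le L_1(\|\theta-\theta^*\|+1)$. (A3) There is $\mu>0$ with $\langle\theta-\theta',\bar g(\theta)-\bar g(\theta')\rangle\le-\mu\|\theta-\theta'\|^2$; $\theta^*$ is the unique root of $\bar g$; $\mu\le 1-r$. (A4), $p=1$: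 $\mathbb E[\xi_{k+1}(\theta)\mid\mathcal F_k]=0$ and $(\mathbb E\|\xi_1(\theta)\|^{2})^{1/2}\le L_2(\|\theta-\theta^*\|+1)$; $C(\theta)=\mathbb E[\xi_1(\theta)\xi_1(\theta)^\top]$ is twice differentiable with $\max_{i=1,2}\|C^{(i)}(\theta)\|\le M(1+\|\theta-\theta^*\|^{m})$. $L:=L_1+L_2\ge1$. (A5) Noise minorization: for each $\theta$, the law $\zeta_\theta$ of $\xi_1(\theta)$ decomposes as $\zeta_\theta=\zeta_{1,\theta}+\zeta_{2,\theta}$ (nonnegative measures), where $\zeta_{1,\theta}$ has a Lebesgue density $p_\theta$ with $\inf_{\theta\in C}p_\theta(t)>0$ for every bounded set $C\subset\mathbb R^d$ and every $t\in\mathbb R^d$. $\mathcal P_2(\mathcal X\times\mathbb R^d)$: distributions on $\mathcal X\times\mathbb R^d$ with square-integrable $\mathbb R^d$-marginal.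
   Formalization: The displayed bound is proved as κ V(x_0,θ_0) ρ^k (standard V-uniform ergodicity) instead of κρ^k uniformly in (x_0,θ_0), since the uniform bound already fails at k=0 because V is unbounded. *)

(* Defs.v *)
From HB Require Import structures.
From mathcomp Require Import all_boot all_order all_algebra.
From mathcomp Require Import all_classical all_reals all_analysis.
Set Implicit Arguments.
Unset Strict Implicit.
Unset Printing Implicit Defensive.
Import Order.TTheory GRing.Theory Num.Theory.
Import numFieldNormedType.Exports.
Local Open Scope classical_set_scope.
Local Open Scope ring_scope.

Section SAdefs.
Context {R : realType}.

Definition dotv {n} (u v : 'rV[R]_n) : R := \sum_(i < n) u ord0 i * v ord0 i.
Definition vnorm {n} (v : 'rV[R]_n) : R := Num.sqrt (dotv v v).
Definition frob {n} (A : 'M[R]_n) : R :=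
  Num.sqrt (\sum_(i < n) \sum_(j < n) A i j ^+ 2).

Definition Rd (n : nat) := g_sigma_algebraType (@open ('rV[R]_n)).

Definition C3 {n} {W : normedModType R} (f : 'rV[R]_n -> W) : Prop :=
  [/\ (forall t, differentiable f t),
      (forall h1 t, differentiable ('D_h1 f) t),
      (forall h1 h2 t, differentiable ('D_h2 ('D_h1 f)) t) &
      (forall h1 h2 h3, continuous ('D_h3 ('D_h2 ('D_h1 f))))].

Definition twice_diff {n} {W : normedModType R} (f : 'rV[R]_n -> W) : Prop :=
  (forall t, differentiable f t) /\ (forall h1 t, differentiable ('D_h1 f) t).

End SAdefs.

Section Markov.
Local Open Scope ereal_scope.
Context {R : realType} {d : measure_display} {T : measurableType d}.

Fixpoint kiter (Q : T -> set T -> \bar R) (k : nat) (z : T) : set T -> \bar R :=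
  match k with
  | 0%N => fun A => (\1_A z)%:E
  | k.+1 => fun A => \int[kiter Q k z]_w Q w A
  end.

Definition tvar (mu1 mu2 : set T -> \bar R) (A : set T) : \bar R :=
  ereal_sup [set s | exists (N : nat) (F : nat -> set T),
     [/\ (forall i, measurable (F i)),
         trivIset [set i | (i < N)%N] F,
         \big[setU/set0]_(i < N) F i = A &
         s = \sum_(i < N) `|mu1 (F i) - mu2 (F i)| ]].

Definition Vnorm (V : T -> R) (mu1 mu2 : set T -> \bar R) : \bar R :=
  \int[tvar mu1 mu2]_z (V z)%:E.

Definition stationary (Q : T -> set T -> \bar R) (nu : set T -> \bar R) : Prop :=
  forall A, measurable A -> \int[nu]_z Q z A = nu A.

End Markov.

Section SAchain.
Local Open Scope ereal_scope.
Context {R : realType} {d : measure_display} {X : measurableType d} {n : nat}.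

(** Transition function of the joint chain (x_k, theta_k) of the unprojected
    iteration theta' = theta + alpha (g(theta,x) + xi(theta)), with
    x' ~ P(x, .) and xi(theta) ~ zeta theta independent. *)
Definition SA_kernel (P : X -> set X -> \bar R) (zeta : Rd n -> set (Rd n) -> \bar R)
  (g : 'rV[R]_n -> X -> 'rV[R]_n) (alpha : R)
  (z : X * Rd n) (A : set (X * Rd n)) : \bar R :=
  \int[P z.1]_x' \int[zeta z.2]_t
     (\1_A ((x', (z.2 + alpha *: (g z.2 z.1 + t) : 'rV[R]_n) : Rd n)
        : X * Rd n))%:E.

Definition gbar (pi : set X -> \bar R) (g : 'rV[R]_n -> X -> 'rV[R]_n)
  (theta : 'rV[R]_n) : 'rV[R]_n :=
  \row_(i < n) fine (\int[pi]_x (g theta x ord0 i)%:E).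

Definition noise_cov (zeta : Rd n -> set (Rd n) -> \bar R) (theta : 'rV[R]_n)
  : 'M[R]_n :=
  \matrix_(i < n, j < n)
     fine (\int[zeta (theta : Rd n)]_t ((t : 'rV[R]_n) ord0 i * (t : 'rV[R]_n) ord0 j)%:E).

End SAchain.

(* Main.v *)
(** Harris' theorem for the chain (x_k, theta_k).

    Drift: with phi_t(x) = <t - theta*, g(t,x)>, the quadratic |t - theta*|^2 has no one-step
    negative drift, but adding 2 alpha times the truncated Poisson solution
    sum_{k < tau} (P^k phi_t - pi phi_t)(x) replaces phi_t by its stationary mean, at most
    - mu |t - theta*|^2, up to errors O(alpha^2 tau L^2) (1 + |t - theta*|^2).

    Overlap: after k steps the law of x_k is close to pi and theta_k is bounded with high
    probability; one further step from bounded theta has a Lebesgue component bounded below,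
    which yields a lower bound on Q^{k+1}(z1, A) + Q^{k+1}(z2, A^c) that is uniform over A and
    over z1, z2 in a sublevel set. Together with the drift this contracts the weighted
    oscillation of test functions (Hairer-Mattingly), and the invariant law is the uniform
    setwise limit of Q^k(z, .). *)

Require Import Defs.
From HB Require Import structures.
From mathcomp Require Import all_boot all_order all_algebra.
From mathcomp Require Import all_classical all_reals all_analysis.
From mathcomp Require Import finmap measurable_realfun ring lra.
Import Order.TTheory GRing.Theory Num.Theory.
Import numFieldNormedType.Exports.
Import HBNNSimple.
Local Open Scope classical_set_scope.
Local Open Scope ring_scope.

Set Implicit Arguments.
Unset Strict Implicit.

(** * Integration of bounded functions and total variation *)

(** The Poisson sum is cut at [tau] because the boundary term it leaves, the [tau]-step mean of phi
    minus its stationary mean, is at most a multiple of alpha times the size of phi; after the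
    factor 2 alpha it is of order alpha^2, like the other errors. Together the errors amount to 36
    alpha^2 tau L^2 (|t - thstar|^2 + 1), and the constant 1/72 makes this half of alpha mu (|t -
    thstar|^2 + 1).

    A common minorizing measure for the joint chain is not at hand: the density bound controls
    [theta] only, while the next [x] follows [P x]. Hence the overlap is estimated for one set A at
    a time.

    The weight V is unbounded, yet every test function is kept bounded: against a probability
    measure its real integral is then linear and monotone without side conditions. Unbounded
    functions occur only as nonnegative majorants in extended integrals, and the V-norm is bounded
    through bounded functions dominated by V. *)

Definition bdd_meas {d} {T : measurableType d} {R : realType} (f : T -> R) :=
  measurable_fun setT f /\ exists M, forall x, `|f x| <= M.

Section bdd_meas_closure.
Context {d} {T : measurableType d} {R : realType}.
Implicit Types f g : T -> R.

Lemma bdd_meas_cst (c : R) : bdd_meas (fun _ : T => c).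
Proof. by split => //; exists `|c|. Qed.

Lemma bdd_measD f g : bdd_meas f -> bdd_meas g -> bdd_meas (fun x => f x + g x).
Proof.
move=> [mf [M fM]] [mg [N gN]]; split; first exact: measurable_funD.
by exists (M + N) => x; rewrite (le_trans (ler_normD _ _))// lerD.
Qed.

Lemma bdd_measM f g : bdd_meas f -> bdd_meas g -> bdd_meas (fun x => f x * g x).
Proof.
move=> [mf [M fM]] [mg [N gN]]; split; first exact: measurable_funM.
by exists (M * N) => x; rewrite normrM ler_pM.
Qed.

Lemma bdd_measZ (c : R) f : bdd_meas f -> bdd_meas (fun x => c * f x).
Proof. by move=> bf; apply: bdd_measM => //; exact: bdd_meas_cst. Qed.

Lemma bdd_measB f g : bdd_meas f -> bdd_meas g -> bdd_meas (fun x => f x - g x).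
Proof.
move=> [mf [M fM]] [mg [N gN]]; split; first exact: measurable_funB.
by exists (M + N) => x; rewrite (le_trans (ler_normB _ _))// lerD.
Qed.

Lemma bdd_meas_indic (A : set T) : measurable A -> bdd_meas (\1_A : T -> R).
Proof.
move=> mA; split; first exact: measurable_indic.
by exists 1 => x; rewrite indicE ger0_norm// lern1 leq_b1.
Qed.

Lemma bdd_meas_sum (I : Type) (s : seq I) (F : I -> T -> R) :
  (forall i, bdd_meas (F i)) -> bdd_meas (fun x => \sum_(i <- s) F i x).
Proof.
move=> bF; elim: s => [|i s IH].
  by under eq_fun do rewrite big_nil; exact: bdd_meas_cst.
by under eq_fun do rewrite big_cons; exact: bdd_measD.
Qed.

End bdd_meas_closure.

Section bdd_integral.
Context {d} {T : measurableType d} {R : realType}.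
Variable mu : {measure set T -> \bar R}.
Hypothesis mu1 : mu setT = 1%E.
Implicit Types f g : T -> R.

Lemma bdd_meas_integrable f : bdd_meas f -> mu.-integrable setT (EFin \o f).
Proof.
move=> [mf [M fM]]; apply: measurable_bounded_integrable => //.
  by rewrite mu1 ltry.
exists M; split; first by rewrite num_real.
by move=> y My x _ /=; rewrite (le_trans (fM x))// ltW.
Qed.

Lemma bdd_integralE f : bdd_meas f ->
  (\int[mu]_x (f x)%:E = (\int[mu]_x f x)%:E)%E.
Proof.
move=> bf; rewrite /Rintegral fineK//.
exact: (integrable_fin_num _ (bdd_meas_integrable bf)).
Qed.

Lemma prob_int_cst (c : R) : \int[mu]_x c = c.
Proof. by rewrite Rintegral_cst// mu1 mulr1. Qed.

Lemma bdd_intD f g : bdd_meas f -> bdd_meas g ->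
  \int[mu]_x (f x + g x) = \int[mu]_x f x + \int[mu]_x g x.
Proof. by move=> bf bg; rewrite RintegralD//; exact: bdd_meas_integrable. Qed.

Lemma bdd_intB f g : bdd_meas f -> bdd_meas g ->
  \int[mu]_x (f x - g x) = \int[mu]_x f x - \int[mu]_x g x.
Proof. by move=> bf bg; rewrite RintegralB//; exact: bdd_meas_integrable. Qed.

Lemma bdd_intZ (c : R) f : bdd_meas f ->
  \int[mu]_x (c * f x) = c * \int[mu]_x f x.
Proof. by move=> bf; rewrite RintegralZl//; exact: bdd_meas_integrable. Qed.

Lemma bdd_int_le f g : bdd_meas f -> bdd_meas g -> (forall x, f x <= g x) ->
  \int[mu]_x f x <= \int[mu]_x g x.
Proof. by move=> bf bg fg; apply: le_Rintegral => //; exact: bdd_meas_integrable. Qed.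

Lemma bdd_int_le_cst f c : bdd_meas f -> (forall x, f x <= c) -> \int[mu]_x f x <= c.
Proof.
by move=> bf fc; rewrite -[leRHS]prob_int_cst; apply: bdd_int_le => //; exact: bdd_meas_cst.
Qed.

Lemma bdd_int_ge_cst f c : bdd_meas f -> (forall x, c <= f x) -> c <= \int[mu]_x f x.
Proof.
by move=> bf fc; rewrite -[leLHS]prob_int_cst; apply: bdd_int_le => //; exact: bdd_meas_cst.
Qed.

Lemma bdd_int_sum (I : Type) (s : seq I) (F : I -> T -> R) :
  (forall i, bdd_meas (F i)) ->
  \int[mu]_x (\sum_(i <- s) F i x) = \sum_(i <- s) \int[mu]_x F i x.
Proof.
move=> bF; elim: s => [|i s IH].
  by under eq_Rintegral do rewrite big_nil; rewrite big_nil prob_int_cst.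
under eq_Rintegral do rewrite big_cons.
by rewrite big_cons bdd_intD ?IH//; exact: bdd_meas_sum.
Qed.

Lemma prob_int_indic (A : set T) : measurable A -> \int[mu]_x \1_A x = fine (mu A).
Proof. by move=> mA; rewrite /Rintegral integral_indic// setIT. Qed.

Lemma prob_finE (A : set T) : measurable A -> mu A = (\int[mu]_x \1_A x)%:E.
Proof.
move=> mA; rewrite -bdd_integralE ?integral_indic ?setIT//.
exact: bdd_meas_indic.
Qed.

(** Bridge between the two kinds of integral: [g] may be unbounded, so the right side is an extended
    integral, to which the drift inequality applies. *)
Lemma bdd_int_abs_le f (g : T -> R) : bdd_meas f -> measurable_fun setT g ->
  (forall x, `|f x| <= g x) -> (`|\int[mu]_x f x|%:E <= \int[mu]_x (g x)%:E)%E.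
Proof.
move=> bf mg fg; have fi := bdd_meas_integrable bf.
have bnf : bdd_meas (fun x => `|f x|).
  case: bf => mf [M fM]; split; first exact: measurableT_comp.
  by exists M => x; rewrite normr_id.
apply: (@le_trans _ _ (\int[mu]_x (`|f x|)%:E)%E).
  by rewrite bdd_integralE// lee_fin le_normr_Rintegral.
apply: ge0_le_integral => //.
- by apply/measurable_EFinP; case: bnf.
- exact/measurable_EFinP.
- by move=> x _; rewrite lee_fin.
Qed.

(** Only the finitely many values of [h] matter, so [phi] may be an arbitrary function and the
    integral is linear in the indicators of the level sets. *)
Lemma simple_comp_sum (h : {nnsfun T >-> R}) (phi : R -> R) (sg : T -> R) (z : T) :
  phi (h z) * sg z =
  \sum_(x <- fset_set (range h)) phi x * (\1_(h @^-1` [set x]) z * sg z).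
Proof.
rewrite (big_fsetD1 (h z))/=; last first.
  by rewrite in_fset_set//; apply/mem_set; exists z.
rewrite indicE mem_set//= mul1r big_seq big1 ?addr0// => x.
rewrite !inE => /andP[xz _]; rewrite indicE memNset/= ?mul0r ?mulr0//.
by move=> /= hx; move: xz; rewrite hx eqxx.
Qed.

Lemma bdd_meas_simple_comp (h : {nnsfun T >-> R}) (phi : R -> R) (sg : T -> R) :
  bdd_meas sg -> bdd_meas (fun z => phi (h z) * sg z).
Proof.
move=> bs; rewrite (_ : (fun z => _) = fun z =>
  \sum_(x <- fset_set (range h)) phi x * (\1_(h @^-1` [set x]) z * sg z)).
  apply: bdd_meas_sum => x; apply: bdd_measZ; apply: bdd_measM => //.
  exact: bdd_meas_indic.
by apply/funext => z; exact: simple_comp_sum.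
Qed.

Lemma bdd_meas_nnsfun (h : {nnsfun T >-> R}) : bdd_meas h.
Proof.
rewrite (_ : (h : T -> R) = fun z => id (h z) * 1).
  exact: (bdd_meas_simple_comp h id (bdd_meas_cst 1)).
by apply/funext => z; rewrite mulr1.
Qed.

Lemma bdd_int_simple_comp (h : {nnsfun T >-> R}) (phi : R -> R) (sg : T -> R) :
  bdd_meas sg ->
  \int[mu]_z (phi (h z) * sg z) =
  \sum_(x <- fset_set (range h)) phi x * \int[mu]_z (\1_(h @^-1` [set x]) z * sg z).
Proof.
move=> bs; under eq_Rintegral do rewrite simple_comp_sum.
have b x : bdd_meas (fun z => \1_(h @^-1` [set x]) z * sg z).
  by apply: bdd_measM => //; exact: bdd_meas_indic.
rewrite bdd_int_sum; last by move=> x; exact: bdd_measZ.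
by apply: eq_bigr => x _; rewrite bdd_intZ.
Qed.

End bdd_integral.

(** * From setwise comparison of measures to comparison of integrals *)

Section total_variation.
Context {d} {T : measurableType d} {R : realType}.
Variables mu1 mu2 : {measure set T -> \bar R}.
Hypothesis mu11 : mu1 setT = 1%E.
Hypothesis mu21 : mu2 setT = 1%E.

(** For a simple [h] below [f], the level sets to which [mu1] gives more mass than [mu2] are united
    into one set. The hypothesis at this set bounds the sum of the positive differences by [D], and
    each value of [h] is at most [B]. Testing a single set keeps the constant [B * D] whatever the
    number of values. *)
Lemma bdd_int_le_tv (D B : R) (f : T -> R) :
  (forall A, measurable A -> (mu1 A <= mu2 A + D%:E)%E) ->
  bdd_meas f -> (forall x, 0 <= f x <= B) ->
  \int[mu1]_x f x <= \int[mu2]_x f x + B * D.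
Proof.
move=> AD bf f0B; rewrite -lee_fin EFinD -bdd_integralE// -(bdd_integralE mu21)//.
have f0 x : (0 <= (f x)%:E)%E by rewrite lee_fin; case/andP: (f0B x).
have B0 : 0 <= B by case/andP: (f0B point) => /le_trans /[apply].
rewrite [leLHS]ge0_integralTE//; apply: ge_ereal_sup => _ [h /= hf <-].
rewrite -integralT_nnsfun.
have b1 : bdd_meas (fun _ : T => 1 : R) by exact: bdd_meas_cst.
have bh := bdd_meas_nnsfun h.
apply: (@le_trans _ _ (\int[mu2]_x (h x)%:E + (B * D)%:E)%E); last first.
  apply: leeD => //; apply: ge0_le_integral => //.
  - by move=> x _; rewrite lee_fin.
  - by apply/measurable_EFinP; case: bh.
  - by apply/measurable_EFinP; case: bf.
rewrite !bdd_integralE// -EFinD lee_fin -lerBlDl.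
pose a (m : {measure set T -> \bar R}) x := \int[m]_z (\1_(h @^-1` [set x]) z * 1).
have E (m : {measure set T -> \bar R}) (phi : R -> R) : m setT = 1%E ->
    \int[m]_z (phi (h z)) = \sum_(x <- fset_set (range h)) phi x * a m x.
  move=> m1; rewrite -(bdd_int_simple_comp m1 h phi b1).
  by apply: eq_Rintegral => z _; rewrite mulr1.
rewrite (E mu1 id)// (E mu2 id)// -sumrB.
(* Marks the values whose level set has the larger [mu1] mass; the other values contribute
   nonpositive terms. *)
pose phi x : R := (a mu2 x < a mu1 x)%R%:R.
have mA : measurable [set z | a mu2 (h z) < a mu1 (h z)].
  rewrite (_ : [set _ | _] = (fun z => phi (h z) * 1) @^-1` [set 1]).
    rewrite -[X in measurable X]setTI.
    by have [+ _] := bdd_meas_simple_comp h phi b1; apply => //; exact: measurable_set1.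
  apply/seteqP; split => z /=; rewrite mulr1 /phi; first by move=> ->.
  by case: ltP => // _ /eqP; rewrite eq_sym oner_eq0.
have phiE z : phi (h z) = \1_[set z | a mu2 (h z) < a mu1 (h z)] z.
  by rewrite /phi indicE; congr (_%:R); rewrite mem_setE.
have := AD _ mA; rewrite (prob_finE mu11 mA) (prob_finE mu21 mA) -EFinD lee_fin -lerBlDl.
rewrite -(eq_Rintegral _ (fun z _ => phiE z)) -(eq_Rintegral _ (fun z _ => phiE z)).
rewrite (E mu1 phi)// (E mu2 phi)// -sumrB => /(ler_wpM2l B0); apply: le_trans.
rewrite mulr_sumr big_seq [leRHS]big_seq; apply: ler_sum => x.
rewrite in_fset_set// => /set_mem[z _ <-]{x}.
rewrite -!mulrBr /phi mulrA; have hB : h z <= B.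
  by rewrite -lee_fin (le_trans (hf z))// lee_fin; case/andP: (f0B z).
have h0 : 0 <= h z by exact: fun_ge0.
case: ltP => [|] /=; rewrite ?mulr1 ?mulr0 ?mul0r => a12.
  by rewrite ler_wpM2r// subr_ge0 ltW.
by rewrite mulr_ge0_le0// subr_le0.
Qed.

End total_variation.

Section prob_of_measure.
Context {d} {T : measurableType d} {R : realType}.
Variable mu : {measure set T -> \bar R}.
Hypothesis mu1 : mu setT = 1%E.

(** The proof of mass one is an argument, so that the structure of a probability measure can be
    attached to a measure for which this is only a hypothesis. *)
Definition prob_of_measure of (mu setT = 1%E) : set T -> \bar R := mu.

HB.instance Definition _ := Measure.on (prob_of_measure mu1).

HB.instance Definition _ := Measure_isProbability.Build _ _ _ (prob_of_measure mu1) mu1.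

End prob_of_measure.

(** * The weighted variation norm by duality *)

Section Vnorm_bound.
Context {d} {T : measurableType d} {R : realType}.
Variables mu1 mu2 : {measure set T -> \bar R}.
Hypothesis mu11 : mu1 setT = 1%E.
Hypothesis mu21 : mu2 setT = 1%E.

(** Take a Hahn decomposition of [mu1 - mu2] and the sign 1 on the positive part, -1 on the negative
    part. The difference of the two integrals over [F] is then the sum of the absolute differences
    on the two pieces of [F]. *)
Lemma Hahn_sign : exists sg : T -> R, [/\ bdd_meas sg, (forall z, `|sg z| <= 1) &
  forall F, measurable F -> `|fine (mu1 F) - fine (mu2 F)| <=
    \int[mu1]_z (\1_F z * sg z) - \int[mu2]_z (\1_F z * sg z)].
Proof.
pose c1 := charge_of_finite_measure (prob_of_measure mu11 : probability T R).
pose c2 := charge_of_finite_measure (prob_of_measure mu21 : probability T R).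
have [P [N [[mP Ppos] [mN Nneg] PN PN0]]] := Hahn_decomposition (cadd c1 (copp c2)).
have bP : bdd_meas (\1_P : T -> R) by exact: bdd_meas_indic.
have bN : bdd_meas (\1_N : T -> R) by exact: bdd_meas_indic.
have oneE z : \1_P z + \1_N z = 1 :> R.
  transitivity (\1_([set: T]) z : R); last by rewrite indicT.
  rewrite -PN !indicE in_setU.
  have : ~ (z \in P /\ z \in N).
    by move=> [zP zN]; have : z \in P `&` N; [rewrite in_setI zP|rewrite PN0 in_set0].
  by case: (z \in P); case: (z \in N) => /= h; rewrite ?addr0 ?add0r//; case: h.
exists (fun z => \1_P z - \1_N z); split; first exact: bdd_measB.
  move=> z; have := oneE z; rewrite !indicE.
  by case: (z \in P); case: (z \in N); rewrite /= => _;
    rewrite ?subrr ?subr0 ?sub0r ?normrN ?normr1 ?normr0.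
move=> F mF.
have E (m : {measure set T -> \bar R}) : m setT = 1%E ->
    \int[m]_z (\1_F z * (\1_P z - \1_N z)) = fine (m (F `&` P)) - fine (m (F `&` N)).
  move=> m1; rewrite -!prob_int_indic; [|exact: measurableI..].
  rewrite -(bdd_intB m1); [|by apply: bdd_meas_indic; exact: measurableI..].
  by apply: eq_Rintegral => z _; rewrite !indicI/= mulrBr.
rewrite !E//.
have E2 (m : {measure set T -> \bar R}) : m setT = 1%E ->
    fine (m F) = fine (m (F `&` P)) + fine (m (F `&` N)).
  move=> m1; rewrite -!prob_int_indic//; [|exact: measurableI..].
  rewrite -(bdd_intD m1); [|by apply: bdd_meas_indic; exact: measurableI..].
  by apply: eq_Rintegral => z _; rewrite !indicI/= -mulrDr oneE mulr1.
rewrite !E2//.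
have pos : fine (mu2 (F `&` P)) <= fine (mu1 (F `&` P)).
  have : (0 <= mu1 (F `&` P) - mu2 (F `&` P))%E.
    exact: Ppos (measurableI _ _ mF mP) (@subIsetr _ _ _).
  rewrite (prob_finE mu11 (measurableI _ _ mF mP)) (prob_finE mu21 (measurableI _ _ mF mP)).
  by rewrite -EFinB lee_fin subr_ge0.
have neg : fine (mu1 (F `&` N)) <= fine (mu2 (F `&` N)).
  have : (mu1 (F `&` N) - mu2 (F `&` N) <= 0)%E.
    exact: Nneg (measurableI _ _ mF mN) (@subIsetr _ _ _).
  rewrite (prob_finE mu11 (measurableI _ _ mF mN)) (prob_finE mu21 (measurableI _ _ mF mN)).
  by rewrite -EFinB lee_fin subr_le0.
by rewrite ler_norml; apply/andP; split; lra.
Qed.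

(** Each piece of a finite partition is controlled by its sign integral, and these integrals add up
    to the one over [B], independently of the partition. *)
Lemma tvar_le_sign (sg : T -> R) (B : set T) : bdd_meas sg ->
  (forall F, measurable F -> `|fine (mu1 F) - fine (mu2 F)| <=
    \int[mu1]_z (\1_F z * sg z) - \int[mu2]_z (\1_F z * sg z)) ->
  (tvar mu1 mu2 B <=
    (\int[mu1]_z (\1_B z * sg z) - \int[mu2]_z (\1_B z * sg z))%:E)%E.
Proof.
move=> bs sgP; apply: ge_ereal_sup => _ [N [F [mF tF FB ->]]].
have mFB : measurable B by rewrite -FB; apply: bigsetU_measurable.
have bF i : bdd_meas (fun z => \1_(F i) z * sg z).
  by apply: bdd_measM => //; exact: bdd_meas_indic.
have E (z : T) : \1_B z * sg z = \sum_(i < N) \1_(F i) z * sg z.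
  rewrite -mulr_suml; congr (_ * _); rewrite -FB.
  have [[i iN Fz]|nB] := pselect ((\bigcup_(i < N) F i) z).
    rewrite -bigcup_mkord indicE mem_set; last by exists i.
    rewrite (bigD1 (Ordinal iN))//= indicE mem_set// big1 ?addr0// => j ji.
    rewrite indicE memNset// => Fjz; move/negP: ji; apply; apply/eqP/val_inj => /=.
    by apply: (tF j i (ltn_ord j) iN); exists z.
  rewrite -bigcup_mkord indicE memNset// big1// => i _.
  by rewrite indicE memNset// => Fz; apply: nB; exists i => //=.
rewrite !(eq_Rintegral _ (fun z _ => E z)).
rewrite !bdd_int_sum// -sumrB -sumEFin; apply: lee_sum => i _.
rewrite (prob_finE mu11 (mF i)) (prob_finE mu21 (mF i)) -EFinB /= lee_fin.
by rewrite !prob_int_indic//; exact: sgP.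
Qed.

(* [tvar] is a bare set function, not a registered measure, so its integral is unfolded to the
   supremum over simple functions; weighting such a function by the Hahn sign produces a
   bounded test function below [V]. *)
Lemma Vnorm_le (V : T -> R) (C : R) : (forall z, 0 <= V z) ->
  (forall f, bdd_meas f -> (forall z, `|f z| <= V z) ->
     \int[mu1]_z f z - \int[mu2]_z f z <= C) ->
  (Vnorm V mu1 mu2 <= C%:E)%E.
Proof.
move=> V0 VC; have [sg [bs sg1 sgP]] := Hahn_sign.
rewrite /Vnorm /integral.
have tv0 : tvar mu1 mu2 set0 = 0%E.
  apply/eqP; rewrite eq_le; apply/andP; split.
    rewrite (le_trans (tvar_le_sign _ bs sgP))// indic0.
    have E0 (m : {measure set T -> \bar R}) : m setT = 1%E -> \int[m]_z (0 z * sg z) = 0.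
      move=> m1; rewrite -[RHS](prob_int_cst m1); apply: eq_Rintegral => z _.
      by rewrite mul0r.
    by rewrite !E0// subrr.
  apply: ereal_sup_ubound; exists 0%N, (fun=> set0); split => //.
  - by rewrite big_ord0.
  - by rewrite big_ord0.
(* The sum defining [sintegral] ranges over all reals; a value outside the range of [h] has empty
   preimage, which [tv0] shows to have variation zero. *)
have sintE (h : {nnsfun T >-> R}) : sintegral (tvar mu1 mu2) h =
    (\sum_(x <- fset_set (range h)) x%:E * tvar mu1 mu2 (h @^-1` [set x]))%E.
  rewrite sintegralET -fsbig_finite//; apply/esym/fsbig_widen => // x [_ Nhx] /=.
  by rewrite preimage10// tv0 mule0.
have -> : (((fun z => (V z)%:E) \_ [set: T])^\- = fun=> 0)%E.
  apply/funext => z; rewrite funenegE patchE mem_setT.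
  by apply/max_idPr; rewrite leeNl oppe0 lee_fin.
rewrite [X in (_ - X)%E](_ : _ = 0%E); last first.
  apply/eqP; rewrite eq_le; apply/andP; split; last first.
    apply: ereal_sup_ubound; exists nnsfun0 => //; rewrite sintE big_seq big1// => x.
    by rewrite in_fset_set// => /set_mem[z _ <-]; rewrite /= mul0e.
  apply: ge_ereal_sup => _ [h /= hf <-]; rewrite sintE big_seq big1// => x.
  rewrite in_fset_set// => /set_mem[z _ <-].
  have -> : h z = 0 by apply/eqP; rewrite eq_le fun_ge0 -lee_fin hf.
  by rewrite mul0e.
rewrite sube0.
apply: ge_ereal_sup => _ [h /= hf <-].
have hV z : h z <= V z.
  have := hf z; rewrite funeposE patchE mem_setT.
  by rewrite (max_idPl _) ?lee_fin.
pose id' := (fun x : R => x).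
apply: (@le_trans _ _
  (\int[mu1]_z (id' (h z) * sg z) - \int[mu2]_z (id' (h z) * sg z))%:E); last first.
  rewrite lee_fin; apply: VC; first exact: bdd_meas_simple_comp.
  by move=> z; rewrite normrM (le_trans _ (hV z))// ger0_norm ?fun_ge0// ler_piMr// fun_ge0.
rewrite !bdd_int_simple_comp// -sumrB sintE -sumEFin big_seq [leRHS]big_seq.
apply: lee_sum => x; rewrite in_fset_set// => /set_mem[z _ <-].
rewrite /id' -mulrBr EFinM; apply: lee_wpmul2l; first by rewrite lee_fin fun_ge0.
exact: tvar_le_sign.
Qed.

End Vnorm_bound.

(** * Markov kernels and their powers *)

Section kernel_pullback.
Context d1 d2 d3 {X : measurableType d1} {Y : measurableType d2}
  {Z : measurableType d3} {R : realType}.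
Variables (f : X -> Y) (k : R.-pker Y ~> Z).

(** Lets a kernel on a factor act on a product, and restricts a kernel on a product to a section.
    The measurability proof is an argument so that the kernel structure is inferred from the
    term. *)
Definition kpullback of measurable_fun setT f :
  X -> {measure set Z -> \bar R} := fun x => k (f x).

Hypothesis mf : measurable_fun setT f.

Let measurable_kpullback U : measurable U ->
  measurable_fun setT (kpullback mf ^~ U).
Proof. by move=> mU; exact: measurableT_comp (measurable_kernel k U mU) mf. Qed.

HB.instance Definition _ :=
  isKernel.Build _ _ _ _ _ (kpullback mf) measurable_kpullback.

Let kpullback_prob x : kpullback mf x setT = 1%E.
Proof. exact: prob_kernel. Qed.

HB.instance Definition _ :=
  Kernel_isProbability.Build _ _ _ _ _ (kpullback mf) kpullback_prob.
End kernel_pullback.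

Section kernel_const.
Context d1 d2 {X : measurableType d1} {Y : measurableType d2} {R : realType}.
Variable nu : probability Y R.

Definition kconst : X -> {measure set Y -> \bar R} := fun=> nu.

Let measurable_kconst U : measurable U -> measurable_fun setT (kconst ^~ U).
Proof. by move=> mU; exact: measurable_cst. Qed.

HB.instance Definition _ := isKernel.Build _ _ _ _ _ kconst measurable_kconst.

Let kconst_prob x : kconst x setT = 1%E.
Proof. exact: probability_setT. Qed.

HB.instance Definition _ := Kernel_isProbability.Build _ _ _ _ _ kconst kconst_prob.
End kernel_const.

Section prob_kernel_comp.
Context d1 d2 d3 {X : measurableType d1} {Y : measurableType d2}
  {Z : measurableType d3} {R : realType}.
Variables (l : R.-pker X ~> Y) (k : R.-pker (X * Y)%type ~> Z).

Definition pkcomp : X -> {measure set Z -> \bar R} := mkcomp l k.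

Let measurable_pkcomp U : measurable U -> measurable_fun setT (pkcomp ^~ U).
Proof. by move=> mU; exact: measurable_fun_mkcomp_sfinite. Qed.

HB.instance Definition _ := isKernel.Build _ _ _ _ _ pkcomp measurable_pkcomp.

Let pkcomp_prob x : pkcomp x setT = 1%E.
Proof.
rewrite /pkcomp /mkcomp/= /kcomp.
under eq_integral do rewrite prob_kernel.
by rewrite integral_cst// mul1e prob_kernel.
Qed.

HB.instance Definition _ := Kernel_isProbability.Build _ _ _ _ _ pkcomp pkcomp_prob.
End prob_kernel_comp.

Lemma pkerT d1 d2 (X : measurableType d1) (Y : measurableType d2) (R : realType)
  (k : R.-pker X ~> Y) x : k x setT = 1%E.
Proof. exact: prob_kernel. Qed.

Lemma bdd_meas_int_kernel d1 d2 (X : measurableType d1) (Y : measurableType d2)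
    (R : realType) (k : R.-pker X ~> Y) (f : Y -> R) :
  bdd_meas f -> bdd_meas (fun x => \int[k x]_y f y).
Proof.
move=> bf; have [mf [M fM]] := bf; split; last first.
  exists M => x; rewrite ler_norml; apply/andP; split.
    apply: (@bdd_int_ge_cst _ _ _ (k x)) => //; first exact: prob_kernel.
    by move=> y; have := fM y; rewrite ler_norml => /andP[].
  apply: (@bdd_int_le_cst _ _ _ (k x)) => //; first exact: prob_kernel.
  by move=> y; have := fM y; rewrite ler_norml => /andP[].
(* Measurability of a parametrized integral is obtained for a nonnegative integrand: [f] is raised
   by its bound [M] and the shift is subtracted afterwards. *)
rewrite (_ : (fun x => _) = fun x => fine (\int[k x]_y (f y + M)%:E)%E - M).
  apply: measurable_funB => //; apply: measurableT_comp => //.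
  apply: measurable_fun_integral_kernel.
  - by move=> U mU; exact: measurable_kernel.
  - by move=> y; rewrite lee_fin -lerBlDr sub0r; have := fM y; rewrite ler_norml => /andP[].
  - by apply/measurable_EFinP; exact: measurable_funD.
apply/funext => x; rewrite -/(Rintegral _ _ (fun y => f y + M)).
rewrite (bdd_intD (pkerT k x))//; last exact: bdd_meas_cst.
by rewrite (prob_int_cst (pkerT k x)) addrK.
Qed.

Lemma bdd_int_pkcomp d1 d2 d3 (X : measurableType d1) (Y : measurableType d2)
    (Z : measurableType d3) (R : realType)
    (l : R.-pker X ~> Y) (k : R.-pker (X * Y)%type ~> Z) (x : X) (f : Z -> R) :
  bdd_meas f ->
  \int[pkcomp l k x]_z f z = \int[l x]_y \int[k (x, y)]_z f z.
Proof.
move=> bf; have [mf [M fM]] := bf.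
have b1 : bdd_meas (fun y => \int[k (x, y)]_z f z).
  exact: (bdd_meas_int_kernel (kpullback k (pair1_measurable x)) bf).
have bM (d : measure_display) (T : measurableType d) : bdd_meas (fun _ : T => M).
  exact: bdd_meas_cst.
have := @integral_kcomp _ _ _ _ _ _ _ l k x (fun z => (f z + M)%:E) _ _.
have -> : (\int[kcomp l k x]_z (f z + M)%:E = (\int[pkcomp l k x]_z f z + M)%:E)%E.
  rewrite -[in RHS](prob_int_cst (pkerT (pkcomp l k) x) M).
  rewrite -(bdd_intD (pkerT (pkcomp l k) x))//.
  by rewrite -(bdd_integralE (pkerT (pkcomp l k) x))//; exact: bdd_measD.
have -> : (\int[l x]_y (\int[k (x, y)]_z (f z + M)%:E) =
           (\int[l x]_y \int[k (x, y)]_z f z + M)%:E)%E.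
  rewrite -[in RHS](prob_int_cst (pkerT l x) M).
  rewrite -(bdd_intD (pkerT l x))//.
  rewrite -(bdd_integralE (pkerT l x)); last exact: bdd_measD.
  apply: eq_integral => y _.
  rewrite -[in RHS](prob_int_cst (pkerT k (x, y)) M).
  rewrite -(bdd_intD (pkerT k (x, y)))//.
  by rewrite -(bdd_integralE (pkerT k (x, y)))//; exact: bdd_measD.
have f0 z : (0 <= (f z + M)%:E)%E.
  by rewrite lee_fin -lerBlDr sub0r; have := fM z; rewrite ler_norml => /andP[].
by move=> /(_ f0) H; apply/(addIr M)/EFin_inj/H/measurable_EFinP/measurable_funD.
Qed.

Section kernel_power.
Context d {Z : measurableType d} {R : realType}.
Variable Q : R.-pker Z ~> Z.

(** The recursion peels off the last step, as in [kiter], but stays within probability kernels, so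
    that measurability and mass one come with every power. *)
Fixpoint kpow (k : nat) : R.-pker Z ~> Z :=
  match k with
  | 0%N => kdirac (@measurable_id _ Z setT)
  | k'.+1 => pkcomp (kpow k') (kpullback Q measurable_snd)
  end.

Lemma kiterE k : kiter (fun z A => Q z A) k = fun z => kpow k z.
Proof.
apply/funext => z; elim: k => [|k IH]; first by apply/funext => A; rewrite /= /kdirac diracE.
by apply/funext => A; rewrite /= IH.
Qed.

Lemma bdd_int_kpow0 z (f : Z -> R) : bdd_meas f -> \int[kpow 0 z]_w f w = f z.
Proof.
move=> [mf _]; rewrite /Rintegral /= /kdirac integral_dirac//; last exact/measurable_EFinP.
by rewrite diracT mul1e.
Qed.

Lemma bdd_int_kpowS k z (f : Z -> R) : bdd_meas f ->
  \int[kpow k.+1 z]_w f w = \int[kpow k z]_w \int[Q w]_u f u.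
Proof. by move=> bf; rewrite bdd_int_pkcomp. Qed.

Lemma bdd_meas_kpow k (f : Z -> R) : bdd_meas f ->
  bdd_meas (fun z => \int[kpow k z]_w f w).
Proof. exact: bdd_meas_int_kernel. Qed.

Lemma bdd_int_kpowD k l z (f : Z -> R) : bdd_meas f ->
  \int[kpow (k + l) z]_w f w = \int[kpow k z]_w \int[kpow l w]_u f u.
Proof.
elim: l f => [|l IH] f bf.
  by rewrite addn0; apply: eq_Rintegral => w _; rewrite bdd_int_kpow0.
rewrite addnS bdd_int_kpowS// IH; last exact: bdd_meas_int_kernel.
by apply: eq_Rintegral => w _; rewrite bdd_int_kpowS.
Qed.

Lemma bdd_int_kpow1 z (f : Z -> R) : bdd_meas f -> \int[kpow 1 z]_w f w = \int[Q z]_u f u.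
Proof.
move=> bf; rewrite bdd_int_kpowS// bdd_int_kpow0//; exact: bdd_meas_int_kernel.
Qed.

End kernel_power.

(** * Harris' theorem *)

Lemma prob_int_affine_le d (T : measurableType d) (R : realType)
    (mu : {measure set T -> \bar R}) (U : T -> R) (a b c : R) :
  mu setT = 1%E -> measurable_fun setT U -> (forall z, 0 <= U z) ->
  0 <= a -> 0 <= b -> (\int[mu]_w (U w)%:E <= c%:E)%E ->
  (\int[mu]_w (a + b * U w)%:E <= (a + b * c)%:E)%E.
Proof.
move=> mu1 mU U0 a0 b0 Uc.
have mUE : measurable_fun setT (fun w => (U w)%:E) by exact/measurable_EFinP.
under eq_integral do rewrite EFinD EFinM.
rewrite ge0_integralD//; last 2 first.
- by move=> w _; rewrite lee_fin mulr_ge0.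
- by apply: emeasurable_funM => //; exact: measurable_cst.
rewrite integral_cst// [X in (_ * X + _)%E](_ : _ = 1%E) ?mule1 ?EFinD; last exact: mu1.
apply: leeD => //; rewrite ge0_integralZl//.
- by rewrite EFinM lee_wpmul2l.
- by move=> w _; rewrite lee_fin.
Qed.

Lemma bernoulli_ineq (R : realType) (t : R) (n : nat) :
  0 <= t <= 1 -> 1 - n%:R * t <= (1 - t) ^+ n.
Proof.
move=> /andP[t0 t1]; elim: n => [|n IH]; first by rewrite mul0r subr0 expr0.
rewrite exprS -natr1 (@le_trans _ _ ((1 - t) * (1 - n%:R * t)))//; last first.
  by rewrite ler_wpM2l// subr_ge0.
have : 0 <= n%:R * t * t by rewrite !mulr_ge0.
nra.
Qed.

(** Turns a contraction every [N] steps into a rate per step. Instead of an [N]-th root of [g],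
    which may be 0, the rate is [1 - t] with [t = (1 - g) / (2 * N)]: by Bernoulli its [N]-th power
    is at least (1 + g) / 2. The constant absorbs the remainder of [k] modulo [N]. *)
Lemma expr_divn_geometric (R : realType) (g : R) (N : nat) :
  0 <= g < 1 -> (0 < N)%N ->
  exists rho C : R, [/\ 0 < rho < 1, 0 < C & forall k, g ^+ (k %/ N) <= C * rho ^+ k].
Proof.
move=> /andP[g0 g1] N0.
have N1 : 1 <= N%:R :> R by rewrite ler1n.
pose t := (1 - g) / (2 * N%:R).
have t0 : 0 < t by rewrite divr_gt0 ?subr_gt0// mulr_gt0//; lra.
have t1 : t <= 2^-1.
  by rewrite /t invfM mulrA mulrAC ler_piMl// ?invr_ge0// mulrC ler_pdivrMl; lra.
have tN : N%:R * t = (1 - g) / 2 by rewrite /t; field; apply/eqP; lra.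
have r0 : 0 < 1 - t by lra.
have rN : g <= (1 - t) ^+ N.
  have t01 : 0 <= t <= 1 by apply/andP; split; lra.
  by apply: le_trans (bernoulli_ineq N t01); rewrite tN; lra.
exists (1 - t), ((1 - t) ^- N); split => //.
- by apply/andP; split => //; lra.
- by rewrite invr_gt0 exprn_gt0.
move=> k; apply: (@le_trans _ _ ((1 - t) ^+ (N * (k %/ N)))).
  by rewrite exprM lerXn2r// ?nnegrE// exprn_ge0// ltW.
rewrite [in leRHS](divn_eq k N) exprD mulnC mulrCA.
apply: ler_peMr; first by rewrite exprn_ge0// ltW.
rewrite ler_pdivlMl ?exprn_gt0// mulr1.
apply: ler_wiXn2l; rewrite ?(ltW r0)//; first by lra.
by rewrite ltnW// ltn_mod.
Qed.

Section Harris.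
Context d {Z : measurableType d} {R : realType}.
Variables (Q : R.-pker Z ~> Z) (U : Z -> R) (gamma K : R).
Hypothesis mU : measurable_fun setT U.
Hypothesis U0 : forall z, 0 <= U z.
Hypothesis gamma01 : 0 <= gamma < 1.
Hypothesis K0 : 0 <= K.
Hypothesis drift : forall z, (\int[Q z]_w (U w)%:E <= (gamma * U z + K)%:E)%E.

(** The fixed point of u => gamma u + K, hence an additive constant that survives any number of
    drift steps. *)
Let K' := K / (1 - gamma).

Let K'0 : 0 <= K'.
Proof. by rewrite divr_ge0// subr_ge0 ltW//; case/andP: gamma01. Qed.

Let K'E : gamma * K' + K = K'.
Proof. by rewrite /K'; field; rewrite subr_eq0 eq_sym lt_eqF//; case/andP: gamma01. Qed.

Lemma drift_kpow k z :
  (\int[kpow Q k z]_w (U w)%:E <= (gamma ^+ k * U z + K')%:E)%E.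
Proof.
have mUE : measurable_fun setT (fun w => (U w)%:E) by exact/measurable_EFinP.
have /andP[g0 g1] := gamma01.
elim: k => [|k IH].
  rewrite /= /kdirac integral_dirac// diracT mul1e lee_fin mul1r lerDl.
  exact: K'0.
have -> : (\int[kpow Q k.+1 z]_w (U w)%:E = \int[kpow Q k z]_w \int[Q w]_u (U u)%:E)%E.
  by apply: (@integral_kcomp _ _ _ _ _ _ _ (kpow Q k) (kpullback Q measurable_snd)).
apply: (@le_trans _ _ (\int[kpow Q k z]_w (K + gamma * U w)%:E)%E).
  apply: ge0_le_integral => //.
  - by move=> w _; apply: integral_ge0 => u _; rewrite lee_fin.
  - apply: measurable_fun_integral_kernel => //.
    + by move=> A mA; exact: measurable_kernel.
  - by apply/measurable_EFinP/measurable_funD => //; exact: measurable_funM.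
  - by move=> w _; rewrite addrC; exact: drift.
apply: (le_trans (prob_int_affine_le (pkerT _ _) mU U0 K0 g0 IH)).
by rewrite lee_fin exprS -{2}K'E mulrDr mulrA; lra.
Qed.

Lemma kpow_abs_le k z (f : Z -> R) (a b : R) : 0 <= a -> 0 <= b -> bdd_meas f ->
  (forall w, `|f w| <= a + b * U w) ->
  `|\int[kpow Q k z]_w f w| <= a + b * (gamma ^+ k * U z + K').
Proof.
move=> a0 b0 bf fU; rewrite -lee_fin; apply: (le_trans (bdd_int_abs_le (pkerT _ _) bf _ fU)).
  by apply: measurable_funD => //; exact: measurable_funM.
by apply: prob_int_affine_le => //; [exact: pkerT|exact: drift_kpow].
Qed.

(** Lipschitz condition with constant [c] for the weighted distance equal to 2 + b (U x + U y)
    between distinct points. One-sided differences suffice since both orders of [x] and [y] are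
    covered. *)
Let osc b c (f : Z -> R) := forall x y, f x - f y <= c * (2 + b * (U x + U y)).

(** Every lower envelope value f x - c (1 + b U x) lies below every upper one f y + c (1 + b U y);
    the supremum of the lower ones separates them. This trades the Lipschitz seminorm for a weighted
    sup norm modulo constants. *)
Lemma osc_center b c f : osc b c f ->
  exists s, forall x, `|f x - s| <= c * (1 + b * U x).
Proof.
move=> fosc; pose S := [set f x - c * (1 + b * U x) | x in [set: Z]].
have ubS y : ubound S (f y + c * (1 + b * U y)).
  by move=> _ [x _ <-]; have := fosc x y; lra.
have S0 : has_sup S.
  split; first by exists (f point - c * (1 + b * U point)), point.
  by exists (f point + c * (1 + b * U point)); exact: ubS.
exists (sup S) => x; rewrite ler_norml; apply/andP; split.
  by have := @ge_sup _ S _ S0.1 (ubS x); lra.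
have : f x - c * (1 + b * U x) <= sup S by apply: ub_le_sup => //; [exact: S0.2|exists x].
by lra.
Qed.

(** Uses the drift alone; for [k] positive it gives a contraction where [U x + U y] is large
    compared with [K']. *)
Lemma kpow_osc k x y (f : Z -> R) b c : 0 <= b -> 0 <= c -> bdd_meas f -> osc b c f ->
  \int[kpow Q k x]_w f w - \int[kpow Q k y]_w f w <=
  c * (2 + b * (gamma ^+ k * (U x + U y) + 2 * K')).
Proof.
move=> b0 c0 bf /osc_center[s fs].
have bs : bdd_meas (fun w => f w - s) by apply: bdd_measB => //; exact: bdd_meas_cst.
have E z : \int[kpow Q k z]_w (f w - s) = \int[kpow Q k z]_w f w - s.
  rewrite (bdd_intB (pkerT _ _))//; last exact: bdd_meas_cst.
  by rewrite (prob_int_cst (pkerT _ _)).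
have H z : `|\int[kpow Q k z]_w (f w - s)| <= c + (c * b) * (gamma ^+ k * U z + K').
  apply: kpow_abs_le => //; first exact: mulr_ge0.
  by move=> w; rewrite (le_trans (fs w))// mulrDr mulr1 mulrA.
have := H x; have := H y; rewrite !E !ler_norml => /andP[h1 h2] /andP[h3 h4].
by lra.
Qed.

(* [f - s] is split into its truncation at height [c], compared in total variation, and a
   remainder dominated by [c * b * U]. *)
Lemma kpow_osc_local N e C x y (f : Z -> R) b c : 0 <= b -> 0 <= c ->
  bdd_meas f -> osc b c f ->
  (forall z1 z2 A, measurable A -> U z1 <= C -> U z2 <= C ->
     e <= fine (kpow Q N z1 A) + fine (kpow Q N z2 (~` A))) ->
  U x <= C -> U y <= C ->
  \int[kpow Q N x]_w f w - \int[kpow Q N y]_w f w <=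
  c * (2 - 2 * e + b * (gamma ^+ N * (U x + U y) + 2 * K')).
Proof.
move=> b0 c0 bf /osc_center[s fs] ov xC yC.
pose f1 w := Num.max (- c) (Num.min c (f w - s)).
pose f2 w := f w - s - f1 w.
have bs : bdd_meas (fun w => f w - s) by apply: bdd_measB => //; exact: bdd_meas_cst.
have f1c w : - c <= f1 w <= c.
  by rewrite /f1 le_max lexx ge_max ge_min lexx/= andbT; lra.
have bf1 : bdd_meas f1.
  split; last by exists c => w; rewrite ler_norml.
  apply: measurable_maxr => //; apply: measurable_minr => //; by case: bs.
have bf2 : bdd_meas f2 by exact: bdd_measB.
have f2b w : `|f2 w| <= 0 + (c * b) * U w.
  have := fs w; rewrite ler_norml => /andP[h1 h2].
  have cbU : 0 <= c * b * U w by rewrite !mulr_ge0.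
  rewrite add0r /f2 /f1 ler_norml.
  by rewrite /Num.max /Num.min; case: ifPn; case: ifPn; rewrite -?leNgt => h3 h4; lra.
have E z : \int[kpow Q N z]_w f w =
    s + \int[kpow Q N z]_w f1 w + \int[kpow Q N z]_w f2 w.
  rewrite -addrA -(bdd_intD (pkerT _ _))// -[X in X + _](prob_int_cst (pkerT (kpow Q N) z)).
  rewrite -(bdd_intD (pkerT _ _))//; [|exact: bdd_meas_cst|exact: bdd_measD].
  by apply: eq_Rintegral => w _; rewrite /f2; lra.
have H z : `|\int[kpow Q N z]_w f2 w| <= 0 + (c * b) * (gamma ^+ N * U z + K').
  by apply: kpow_abs_le => //; exact: mulr_ge0.
(* [f1 + c] takes values in [0, 2c], and overlap applied to the complement of A says that the mass
   of A from [x] exceeds the mass from [y] by at most [1 - e]. *)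
have TV : \int[kpow Q N x]_w (f1 w + c) <= \int[kpow Q N y]_w (f1 w + c) + (2 * c) * (1 - e).
  apply: bdd_int_le_tv; [exact: pkerT|exact: pkerT| | |].
  - move=> A mA; have mA' := measurableC mA.
    have := ov x y (~` A) mA' xC yC; rewrite setCK.
    have -> : kpow Q N x (~` A) = (1 - fine (kpow Q N x A))%:E.
      have -> : (kpow Q N x (~` A) = 1 - kpow Q N x A)%E.
        exact: (probability_setC (prob_of_measure (pkerT (kpow Q N) x)) mA).
      by rewrite (prob_finE (pkerT (kpow Q N) x) mA) -EFinB.
    rewrite (prob_finE (pkerT (kpow Q N) x) mA) (prob_finE (pkerT (kpow Q N) y) mA) /=.
    by rewrite -EFinD lee_fin; lra.
  - by apply: bdd_measD => //; exact: bdd_meas_cst.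
  - by move=> w; have := f1c w; lra.
have E1 z : \int[kpow Q N z]_w (f1 w + c) = \int[kpow Q N z]_w f1 w + c.
  by rewrite (bdd_intD (pkerT _ _)) ?(prob_int_cst (pkerT _ _))//; exact: bdd_meas_cst.
rewrite !E; move: TV; rewrite !E1.
have := H x; have := H y; rewrite !ler_norml => /andP[h1 h2] /andP[h3 h4].
by lra.
Qed.

(* A Dobrushin-type condition on sublevel sets; no common minorizing measure is needed. *)
Hypothesis overlap : forall C, exists N e, [/\ (0 < N)%N, 0 < e &
  forall z1 z2 A, measurable A -> U z1 <= C -> U z2 <= C ->
    e <= fine (kpow Q N z1 A) + fine (kpow Q N z2 (~` A))].

(** Two regimes for S = U x + U y. Below the threshold, overlap lowers the term 2 by 2e, and [b] is
    small enough for the drift terms to give back at most e. Above it, the drift shrinks b S by a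
    factor that outweighs 2 K'. *)
Lemma kpow_contraction : exists N b g, [/\ (0 < N)%N, 0 < b, 0 <= g < 1 &
  forall f c, 0 <= c -> bdd_meas f -> osc b c f ->
    osc b (c * g) (fun z => \int[kpow Q N z]_w f w)].
Proof.
have /andP[g0 g1] := gamma01.
(* Beyond 4 K' / (1 - gamma) the term 2 K' is at most (1 - gamma) S / 2; the added 1 ensures S >= 1
   there, so that 2 + b S <= (2 + b) S. *)
pose Rr := 4 * K' / (1 - gamma) + 1.
have Rr1 : 1 <= Rr.
  by rewrite lerDr; apply: divr_ge0; [exact: mulr_ge0|lra].
have [N [e [N0 e0 ov]]] := overlap Rr.
have den0 : 0 < Rr + 2 * K' by apply: ltr_wpDr; [exact: mulr_ge0|exact: lt_le_trans Rr1].
(* The weight is fixed after [e], so that the drift terms b (gamma^N S + 2 K') cost at most half of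
   the gain 2e. *)
have [b b0 bE] : exists2 b, 0 < b & b * (Rr + 2 * K') = e.
  by exists (e / (Rr + 2 * K')); [rewrite divr_gt0|rewrite mulfVK// gt_eqF].
(* The gain b (1 - gamma) S / 2 of the large regime, expressed as a fraction of (2 + b) S. *)
have [h h0 hE] : exists2 h, 0 < h & h * (2 + b) = b * (1 - gamma) / 2.
  have b2 : 0 < 2 + b by lra.
  exists (b * (1 - gamma) / 2 / (2 + b)); last by rewrite mulfVK// gt_eqF.
  by rewrite !divr_gt0// mulr_gt0// subr_gt0.
have gN : 0 <= gamma ^+ N <= gamma.
  rewrite exprn_ge0//=; have := @ler_wiXn2l _ _ g0 (ltW g1) _ _ N0.
  by rewrite expr1.
exists N, b, (Num.max 0 (Num.max (1 - e / 2) (1 - h))); split => //.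
  by rewrite le_max lexx/= !gt_max ltr01/=; apply/andP; split; lra.
move=> f c c0 bf fosc x y.
set S := U x + U y; have S0 : 0 <= S by rewrite addr_ge0.
have K'p := K'0.
have gNS : gamma ^+ N * S <= gamma * S by rewrite ler_wpM2r//; case/andP: gN.
have [SR|RS] := leP S Rr.
  have xC : U x <= Rr by have := U0 y; rewrite /S in SR; lra.
  have yC : U y <= Rr by have := U0 x; rewrite /S in SR; lra.
  apply: (le_trans (kpow_osc_local (ltW b0) c0 bf fosc ov xC yC)).
  rewrite -mulrA ler_wpM2l//.
  apply: (@le_trans _ _ ((1 - e / 2) * (2 + b * S))); last first.
    by rewrite ler_wpM2r ?le_max ?lexx ?orbT// addr_ge0// mulr_ge0// ltW.
  rewrite -/S.
  have : b * (gamma ^+ N * S + 2 * K') <= e.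
    rewrite -bE ler_wpM2l ?(ltW b0)//.
    by rewrite lerD2r (le_trans gNS)// (le_trans _ SR)// ler_piMl// ltW.
  have : 0 <= b * S by rewrite mulr_ge0// ltW.
  have e1 : e <= 1.
    have := ov x x setT measurableT xC xC.
    by rewrite setCT measure0 (pkerT (kpow Q N) x) /= addr0.
  nra.
apply: (le_trans (kpow_osc N x y (ltW b0) c0 bf fosc)).
rewrite -mulrA ler_wpM2l//.
apply: (@le_trans _ _ ((1 - h) * (2 + b * S))); last first.
  by rewrite ler_wpM2r ?le_max ?lexx ?orbT// addr_ge0// mulr_ge0// ltW.
rewrite -/S.
have S1 : 1 <= S by lra.
have KS : 2 * K' <= (1 - gamma) * S / 2.
  have : 4 * K' / (1 - gamma) <= S by rewrite /Rr in RS; lra.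
  by rewrite ler_pdivrMr ?subr_gt0//; lra.
have hS : h * (2 + b * S) <= b * (1 - gamma) / 2 * S.
  rewrite -hE -mulrA ler_wpM2l ?(ltW h0)//; nra.
have : b * (gamma ^+ N * S + 2 * K') <= b * (gamma * S + (1 - gamma) * S / 2).
  by rewrite ler_wpM2l ?(ltW b0)// lerD.
by lra.
Qed.

Lemma kpow_geometric : exists rho C, [/\ 0 < rho < 1, 0 < C &
  forall f, bdd_meas f -> (forall z, `|f z| <= 1 + U z) ->
    forall k x y, \int[kpow Q k x]_w f w - \int[kpow Q k y]_w f w <=
      C * rho ^+ k * (1 + U x + U y)].
Proof.
have /andP[g0 g1] := gamma01.
have [N [b [g [N0 b0 gg contr]]]] := kpow_contraction.
have [rho [C [r01 C0 rhoC]]] := expr_divn_geometric gg N0.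
have K'p := K'0.
(* One oscillation constant for all iterates [i] of [f]: the part 1 + K' bounds the constant term
   and 1/b rescales [U] to [b * U]. Uniformity in [i] lets the k mod N leftover steps be taken
   before the contractions. *)
pose c0 := 1 + K' + b^-1.
have c00 : 0 < c0 by rewrite /c0 ltr_wpDl ?invr_gt0//; lra.
exists rho, (c0 * C * (2 + b)); split => //.
  by rewrite !mulr_gt0//; lra.
move=> f bf fU k x y.
have /andP[gg0 _] := gg.
have oscf i : osc b c0 (fun z => \int[kpow Q i z]_w f w).
  move=> u v.
  have H z : `|\int[kpow Q i z]_w f w| <= 1 + 1 * (gamma ^+ i * U z + K').
    by apply: kpow_abs_le => // w; rewrite mul1r.
  have gi z : gamma ^+ i * U z <= U z.
    by rewrite ler_piMl// exprn_ile1// ltW.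
  have := H u; have := H v; rewrite !ler_norml => /andP[h1 h2] /andP[h3 h4].
  have := gi u; have := gi v => h5 h6.
  have bb : b^-1 * (b * (U u + U v)) = U u + U v by rewrite mulKf// gt_eqF.
  have : 0 <= (1 + K') * (b * (U u + U v)).
    by rewrite !mulr_ge0 ?addr_ge0// ltW.
  have bi : 0 < b^-1 by rewrite invr_gt0.
  rewrite /c0; nra.
have oscj j i : osc b (c0 * g ^+ j) (fun z => \int[kpow Q (N * j + i) z]_w f w).
  elim: j i => [|j IH] i; first by rewrite muln0 add0n expr0 mulr1.
  have -> : (fun z => \int[kpow Q (N * j.+1 + i) z]_w f w) =
      (fun z => \int[kpow Q N z]_w \int[kpow Q (N * j + i) w]_u f u).
    by apply/funext => z; rewrite mulnS -addnA bdd_int_kpowD.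
  rewrite exprSr mulrA; apply: contr => //.
  - by rewrite mulr_ge0 ?exprn_ge0// ltW.
  - exact: bdd_meas_kpow.
have := oscj (k %/ N)%N (k %% N)%N x y; rewrite mulnC -divn_eq => /le_trans; apply.
have S0 : 0 <= U x + U y by rewrite addr_ge0.
apply: (@le_trans _ _ (c0 * (C * rho ^+ k) * (2 + b * (U x + U y)))).
  rewrite ler_wpM2r//; first by rewrite addr_ge0// mulr_ge0// ltW.
  by rewrite ler_wpM2l// ltW.
rewrite -!mulrA ler_wpM2l ?(ltW c00)// ler_wpM2l ?(ltW C0)//.
rewrite mulrCA ler_wpM2l//; first by rewrite exprn_ge0// ltW//; case/andP: r01.
by nra.
Qed.

End Harris.

(** * Limits of uniformly Cauchy sequences of probability measures *)

Section uniform_setwise_limit.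
Context {d} {T : measurableType d} {R : realType}.
Variables (m : nat -> {measure set T -> \bar R}) (e : nat -> R).
Hypothesis m1 : forall k, m k setT = 1%E.
Hypothesis e0 : e @ \oo --> 0.
Hypothesis mC : forall k l A, measurable A ->
  `|fine (m (l + k) A) - fine (m k A)| <= e k.

(* The norm only matters on non-measurable sets, where the limit may not exist. *)
Definition setwise_limit of (forall k, m k setT = 1%E) & e @ \oo --> 0 &
    (forall k l A, measurable A -> `|fine (m (l + k) A) - fine (m k A)| <= e k) :
  set T -> \bar R := fun A => `|limn (fun k => fine (m k A))|%:E.

Local Notation nu := (setwise_limit m1 e0 mC).

Let m_cvg A : measurable A -> cvgn (fun k => fine (m k A)).
Proof.
move=> mA; apply: cauchy_cvg; apply: cauchy_exP => eps eps0.
have /cvgrPdist_lt/(_ _ eps0)[k _ ke] := e0.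
exists (fine (m k A)); exists k => // n /= kn; rewrite /ball/= distrC.
rewrite -(subnK kn) (le_lt_trans (mC _ _ mA))//.
have := ke k (leqnn k); rewrite sub0r normrN; apply: le_lt_trans; exact: ler_norm.
Qed.

Let m_cvgE A : measurable A -> fine (m k A) @[k --> \oo] --> fine (nu A).
Proof.
move=> mA; have := m_cvg mA; rewrite /setwise_limit /= => ml.
rewrite ger0_norm//; apply: limr_ge => //.
by apply: nearW => k; rewrite fine_ge0.
Qed.

Lemma setwise_limit_dist k A : measurable A -> `|fine (nu A) - fine (m k A)| <= e k.
Proof.
move=> mA; apply/ler_addgt0Pr => eps eps0.
have /cvgrPdist_lt/(_ _ eps0)[N _ Ne] := m_cvgE mA.
have := Ne (N + k)%N (leq_addr _ _) => h1; have := mC k N mA => h2.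
rewrite (_ : _ - _ = (fine (nu A) - fine (m (N + k)%N A)) +
  (fine (m (N + k)%N A) - fine (m k A))); last by lra.
by rewrite (le_trans (ler_normD _ _))// addrC lerD// ltW.
Qed.

Let nu0 : nu set0 = 0%E.
Proof.
rewrite /setwise_limit (_ : (fun k => _) = fun=> 0); first by rewrite lim_cst// normr0.
by apply/funext => k; rewrite measure0.
Qed.

Let nu_ge0 A : (0 <= nu A)%E.
Proof. by rewrite lee_fin. Qed.

(** Since [e k] bounds the distance on all sets at once, one [k] serves for every partial union and
    for the full union; countable additivity of that single [m k] then gives the claim with three
    errors of eps / 3. *)
Let nu_sigma : semi_sigma_additive nu.
Proof.
move=> F mF tF mUF.
have mB n : measurable (\big[setU/set0]_(i < n) F i) by exact: bigsetU_measurable.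
have mfin k A : measurable A -> m k A = (fine (m k A))%:E.
  by move=> mA; rewrite (prob_finE (m1 k) mA).
have mS k n : fine (m k (\big[setU/set0]_(i < n) F i)) = \sum_(0 <= i < n) fine (m k (F i)).
  apply: EFin_inj; rewrite -mfin// measure_semi_additive_ord_I//; last first.
    exact: sub_trivIset tF.
  by rewrite -sumEFin big_mkord; apply: eq_bigr => i _; rewrite -mfin.
have nS n : (\sum_(0 <= i < n) nu (F i) = (fine (nu (\big[setU/set0]_(i < n) F i)))%:E)%E.
  have <- : \sum_(0 <= i < n) fine (nu (F i)) = fine (nu (\big[setU/set0]_(i < n) F i)).
    have h1 : fine (m k (\big[setU/set0]_(i < n) F i)) @[k --> \oo] -->
        \sum_(0 <= i < n) fine (nu (F i)).
      under eq_fun do rewrite mS.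
      apply: cvg_big => [|i _]; [exact: add_continuous|exact: m_cvgE].
    by rewrite -(cvg_lim (@Rhausdorff R) h1) -(cvg_lim (@Rhausdorff R) (m_cvgE (mB n))).
  by rewrite -sumEFin.
apply: cvg_EFin; first by apply: nearW => n; rewrite nS.
rewrite (_ : fine \o (fun n => \sum_(0 <= i < n) nu (F i))%E =
  fun n => fine (nu (\big[setU/set0]_(i < n) F i))); last first.
  by apply/funext => n /=; rewrite nS.
apply/cvgrPdist_lt => eps eps0.
have eps3 : 0 < eps / 3 by rewrite divr_gt0.
have /cvgrPdist_lt/(_ _ eps3)[k _ ke] := e0.
have ek : e k < eps / 3.
  have := ke k (leqnn k); rewrite sub0r normrN; apply: le_lt_trans; exact: ler_norm.
have : fine (m k (\big[setU/set0]_(i < n) F i)) @[n --> \oo] --> fine (m k (\bigcup_n F n)).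
  under eq_fun do rewrite mS.
  have := @measure_semi_sigma_additive _ _ _ (m k) F mF tF mUF.
  rewrite mfin// => /fine_cvgP[_]; apply: cvg_trans.
  apply: near_eq_cvg; apply: nearW => n /=.
  rewrite (eq_bigr (fun i => (fine (m k (F i)))%:E)) ?sumEFin//.
  by move=> i _; rewrite -mfin.
move=> /cvgrPdist_lt/(_ _ eps3)[N _ Ne]; exists N => // n Nn.
have h1 := Ne n Nn; have h2 := setwise_limit_dist k (mB n).
have h3 := setwise_limit_dist k mUF; rewrite -/(fine (nu _)).
move: h1 h2 h3; rewrite /= -/(nu _) !ltr_norml !ler_norml => /andP[? ?] /andP[? ?] /andP[? ?].
by apply/andP; split; lra.
Qed.

HB.instance Definition _ := isMeasure.Build _ _ _ nu nu0 nu_ge0 nu_sigma.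

Let nuT : nu setT = 1%E.
Proof.
rewrite /setwise_limit (_ : (fun k => _) = fun=> 1); first by rewrite lim_cst// normr1.
by apply/funext => k; rewrite m1.
Qed.

HB.instance Definition _ := Measure_isProbability.Build _ _ _ nu nuT.

Lemma setwise_limit_prob : exists nu : probability T R,
  forall k A, measurable A -> `|fine (nu A) - fine (m k A)| <= e k.
Proof. by exists nu => k A mA; exact: setwise_limit_dist. Qed.

End uniform_setwise_limit.

Lemma cvg_eq_of_dist (R : realType) (a : nat -> R) (x y : R) (e1 e2 : nat -> R) :
  e1 @ \oo --> 0 -> e2 @ \oo --> 0 ->
  (forall k, `|x - a k| <= e1 k) -> (forall k, `|y - a k| <= e2 k) -> x = y.
Proof.
move=> h1 h2 xa ya; apply/eqP; rewrite -subr_eq0 -normr_le0.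
have h3 : e1 k + e2 k @[k --> \oo] --> 0 by rewrite -[0]addr0; exact: cvgD.
rewrite -(cvg_lim (@Rhausdorff R) h3); apply: limr_ge; first by apply/cvg_ex; exists 0.
apply: nearW => k; rewrite (_ : x - y = (x - a k) - (y - a k)); last by lra.
by rewrite (le_trans (ler_normB _ _))// lerD.
Qed.

Lemma bdd_int_tv_dist d (T : measurableType d) (R : realType)
    (mu1 mu2 : {measure set T -> \bar R}) (D M : R) (f : T -> R) :
  mu1 setT = 1%E -> mu2 setT = 1%E ->
  (forall A, measurable A -> `|fine (mu1 A) - fine (mu2 A)| <= D) ->
  measurable_fun setT f -> (forall x, `|f x| <= M) ->
  `|\int[mu1]_x f x - \int[mu2]_x f x| <= 2 * M * D.
Proof.
move=> m1 m2 AD mf fM.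
have bf : bdd_meas f by split => //; exists M.
have bM : bdd_meas (fun _ : T => M) by exact: bdd_meas_cst.
have f0 x : 0 <= f x + M <= 2 * M.
  by have := fM x; rewrite ler_norml => /andP[? ?]; apply/andP; split; lra.
have E (mu : {measure set T -> \bar R}) : mu setT = 1%E ->
    \int[mu]_x (f x + M) = \int[mu]_x f x + M.
  by move=> mu1'; rewrite (bdd_intD mu1')// (prob_int_cst mu1').
have H (mu mu' : {measure set T -> \bar R}) : mu setT = 1%E -> mu' setT = 1%E ->
    (forall A, measurable A -> `|fine (mu A) - fine (mu' A)| <= D) ->
    \int[mu]_x (f x + M) <= \int[mu']_x (f x + M) + 2 * M * D.
  move=> h h' hD; apply: (bdd_int_le_tv h h') => //; last exact: bdd_measD.
  move=> A mA; have := hD A mA; rewrite (prob_finE h mA) (prob_finE h' mA) /=.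
  by rewrite -EFinD lee_fin ler_norml => /andP[_]; lra.
have := H mu1 mu2 m1 m2 AD; have := H mu2 mu1 m2 m1.
rewrite !E// => /(_ _)/wrap[|h1 h2]; first by move=> A mA; rewrite distrC; exact: AD.
by rewrite ler_norml; apply/andP; split; lra.
Qed.

(** Stationarity identifies, on sets, [nu] with the composition of the constant kernel [nu] and [Q];
    the composition formula carries this over to bounded functions. *)
Lemma stationary_int d (Z : measurableType d) (R : realType) (Q : R.-pker Z ~> Z)
    (nu : probability Z R) (f : Z -> R) :
  stationary (fun z A => Q z A) nu -> bdd_meas f ->
  \int[nu]_z \int[Q z]_w f w = \int[nu]_z f z.
Proof.
move=> nuQ bf.
have := bdd_int_pkcomp (kconst nu : R.-pker Z ~> Z) (kpullback Q measurable_snd) point bf.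
rewrite /kconst /kpullback/= => <-; congr fine.
apply: eq_measure_integral => A mA _.
exact: (nuQ A mA).
Qed.

Lemma stationary_kpow d (Z : measurableType d) (R : realType) (Q : R.-pker Z ~> Z)
    (nu : probability Z R) (f : Z -> R) k :
  stationary (fun z A => Q z A) nu -> bdd_meas f ->
  \int[nu]_z \int[kpow Q k z]_w f w = \int[nu]_z f z.
Proof.
move=> nuQ; elim: k f => [|k IH] f bf.
  by apply: eq_Rintegral => z _; rewrite bdd_int_kpow0.
under eq_Rintegral do rewrite bdd_int_kpowS//.
by rewrite IH ?stationary_int//; exact: bdd_meas_int_kernel.
Qed.

(** * Existence, uniqueness and convergence to the invariant law *)

Section Harris_theorem.
Context {d} {Z : measurableType d} {R : realType}.
Variables (Q : R.-pker Z ~> Z) (U : Z -> R) (gamma K : R).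
Hypothesis mU : measurable_fun setT U.
Hypothesis U0 : forall z, 0 <= U z.
Hypothesis gamma01 : 0 <= gamma < 1.
Hypothesis K0 : 0 <= K.
Hypothesis drift : forall z, (\int[Q z]_w (U w)%:E <= (gamma * U z + K)%:E)%E.
Hypothesis overlap : forall C, exists N e, [/\ (0 < N)%N, 0 < e &
  forall z1 z2 A, measurable A -> U z1 <= C -> U z2 <= C ->
    e <= fine (kpow Q N z1 A) + fine (kpow Q N z2 (~` A))].

(** Convergence is stated on bounded test functions dominated by [1 + U], the form in which
    [Vnorm_le] consumes it. *)
Theorem Harris : exists nubar : probability Z R,
  [/\ stationary (fun z A => Q z A) nubar,
      (\int[nubar]_z (U z)%:E < +oo)%E,
      (forall nu' : probability Z R, stationary (fun z A => Q z A) nu' ->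
         forall A, measurable A -> nu' A = nubar A) &
      exists rho kappa, [/\ 0 < rho < 1, 0 < kappa &
        forall z k f, bdd_meas f -> (forall w, `|f w| <= 1 + U w) ->
          `|\int[kpow Q k z]_w f w - \int[nubar]_w f w| <= kappa * rho ^+ k * (1 + U z)]].
Proof.
have [rho [C [r01 C0 geo]]] := kpow_geometric mU U0 gamma01 K0 drift overlap.
have /andP[r0 r1] := r01.
pose K' := K / (1 - gamma).
have K'0 : 0 <= K' by rewrite divr_ge0// subr_ge0 ltW//; case/andP: gamma01.
have drift' k z : (\int[kpow Q k z]_w (U w)%:E <= (U z + K')%:E)%E.
  apply: (le_trans (drift_kpow mU U0 gamma01 K0 drift k z)).
  have /andP[g0 g1] := gamma01.
  by rewrite lee_fin lerD2r ler_piMl// exprn_ile1// ltW.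
(* The difference is the [l]-step mean from [z'] of the [k]-step difference between a random point
   and [z]. The geometric bound is affine in [U], whose [l]-step mean is bounded uniformly in
   [l]. *)
have cauchy f k l z z' : bdd_meas f -> (forall w, `|f w| <= 1 + U w) ->
    `|\int[kpow Q (l + k) z']_w f w - \int[kpow Q k z]_w f w| <=
    C * rho ^+ k * (1 + U z + (U z' + K')).
  move=> bf fU; pose c := \int[kpow Q k z]_w f w.
  have bk := bdd_meas_kpow Q k bf.
  have Cr : 0 <= C * rho ^+ k by rewrite mulr_ge0 ?exprn_ge0// ltW.
  rewrite bdd_int_kpowD// -/c -(prob_int_cst (pkerT (kpow Q l) z') c).
  rewrite -(bdd_intB (pkerT (kpow Q l) z'))//; last exact: bdd_meas_cst.
  rewrite -lee_fin.
  have b2 : bdd_meas (fun w => \int[kpow Q k w]_u f u - c).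
    by apply: bdd_measB => //; exact: bdd_meas_cst.
  apply: (le_trans (bdd_int_abs_le (pkerT (kpow Q l) z') b2
    (g := fun w => C * rho ^+ k * (1 + U z) + C * rho ^+ k * U w) _ _)).
  - by apply: measurable_funD => //; exact: measurable_funM.
  - move=> w; have h1 := geo f bf fU k w z; have h2 := geo f bf fU k z w.
    by rewrite ler_norml /c; apply/andP; split; lra.
  - apply: (le_trans (prob_int_affine_le (pkerT (kpow Q l) z') mU U0 _ Cr (drift' l z'))).
      by rewrite mulr_ge0// addr_ge0.
    by rewrite lee_fin; lra.
pose z0 : Z := point.
pose B := 1 + U z0 + (U z0 + K').
have rcvg (c : R) : c * rho ^+ k @[k --> \oo] --> 0.
  by apply: cvg_geometric; rewrite ger0_norm// ltW.
have rcvg' (c c' : R) : c * rho ^+ k * c' @[k --> \oo] --> 0.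
  by under eq_fun do rewrite mulrAC; exact: rcvg.
have [nu nuP] : exists nu : probability Z R, forall k A, measurable A ->
    `|fine (nu A) - fine (kpow Q k z0 A)| <= C * rho ^+ k * B.
  apply: (@setwise_limit_prob _ _ _ (fun k => kpow Q k z0)).
  - by move=> k; exact: pkerT.
  - exact: rcvg'.
  - move=> k l A mA; rewrite -!prob_int_indic//; apply: cauchy; first exact: bdd_meas_indic.
    move=> w; rewrite indicE ger0_norm//.
    by rewrite (le_trans _ (_ : 1 <= _))// ?lern1 ?leq_b1// lerDl.
have nuT : nu setT = 1%E by exact: probability_setT.
have nu_int (f : Z -> R) (M : R) k : measurable_fun setT f -> (forall x, `|f x| <= M) ->
    `|\int[nu]_w f w - \int[kpow Q k z0]_w f w| <= 2 * M * (C * rho ^+ k * B).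
  by move=> mf fM; apply: bdd_int_tv_dist => //; [exact: pkerT|exact: nuP].
have nu_cvg (M : R) : 2 * M * (C * rho ^+ k * B) @[k --> \oo] --> 0.
  by rewrite -[0](mulr0 (2 * M)); apply: cvgM; [exact: cvg_cst|exact: rcvg'].
(* Setwise convergence to [nu] has a constant depending on the bound [M] of [f]. It is used only at
   time [N + k] with [N] large, where it contributes less than [eps]; the remaining estimate is free
   of [M]. *)
have conv z k (f : Z -> R) : bdd_meas f -> (forall w, `|f w| <= 1 + U w) ->
    `|\int[kpow Q k z]_w f w - \int[nu]_w f w| <= C * rho ^+ k * (1 + U z + (U z0 + K')).
  move=> [mf [M fM]] fU; apply/ler_addgt0Pr => eps eps0.
  have /cvgrPdist_lt/(_ _ eps0)[N _ Ne] := nu_cvg M.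
  have := Ne (N + k)%N (leq_addr k N); rewrite sub0r normrN => h1.
  have h2 := nu_int f M (N + k)%N mf fM.
  have h3 := cauchy f k N z z0 (conj mf (ex_intro _ M fM)) fU.
  rewrite (_ : _ - _ = (\int[kpow Q k z]_w f w - \int[kpow Q (N + k) z0]_w f w) +
    (\int[kpow Q (N + k) z0]_w f w - \int[nu]_w f w)); last by lra.
  rewrite (le_trans (ler_normD _ _))// lerD//; first by rewrite distrC.
  rewrite distrC (le_trans h2)// ltW// (le_lt_trans _ h1)//; exact: ler_norm.
exists nu; split.
(* Both sides are limits of the mass of A at time [k.+1] from [z0], once as the [k]-step integral of
   the one-step probability and once directly. *)
- move=> A mA.
  have bA : bdd_meas (\1_A : Z -> R) by exact: bdd_meas_indic.
  have bQ := bdd_meas_int_kernel Q bA.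
  have -> : (\int[nu]_z Q z A = \int[nu]_z (\int[Q z]_w \1_A w)%:E)%E.
    by apply: eq_integral => z _; rewrite (prob_finE (pkerT Q z) mA).
  rewrite (bdd_integralE nuT)// (prob_finE nuT mA); congr EFin.
  have [mA1 [M1 fM1]] := bA; have [mQ1 [M2 fM2]] := bQ.
  apply: (@cvg_eq_of_dist _ (fun k => \int[kpow Q k.+1 z0]_w \1_A w) _ _
    (fun k => 2 * M2 * (C * rho ^+ k * B)) (fun k => 2 * M1 * (C * rho ^+ k.+1 * B))).
  + exact: nu_cvg.
  + have := nu_cvg M1; rewrite -(cvg_shiftS (fun k => 2 * M1 * (C * rho ^+ k * B))).
    exact.
  + by move=> k; rewrite bdd_int_kpowS//; exact: nu_int.
  + by move=> k; exact: nu_int.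
(* Each simple function below [U] is bounded, so its [nu]-integral is approximated within 1 by an
   [N]-step mean, which the drift bounds by [U z0 + K']. *)
- apply: (@le_lt_trans _ _ (U z0 + K' + 1)%:E); last by rewrite ltry.
  rewrite ge0_integralTE; last by move=> z; rewrite lee_fin.
  apply: ge_ereal_sup => _ [h /= hU <-].
  have bh := bdd_meas_nnsfun h.
  rewrite -integralT_nnsfun (bdd_integralE nuT)// lee_fin.
  have [mh [M hM]] := bh.
  have /cvgrPdist_lt/(_ 1 ltr01)[N _ Ne] := nu_cvg M.
  have := Ne N (leqnn _); rewrite sub0r normrN => h1.
  have := nu_int h M N mh hM; rewrite ler_norml => /andP[_ h2].
  have h3 : \int[kpow Q N z0]_w h w <= U z0 + K'.
    rewrite -lee_fin -(bdd_integralE (pkerT _ _))//; apply: le_trans (drift' N z0).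
    apply: ge0_le_integral => //; first by move=> x _; rewrite lee_fin.
    + exact/measurable_EFinP.
    + exact/measurable_EFinP.
  have := ler_norm (2 * M * (C * rho ^+ N * B)).
  by lra.
(* The [nu']-mean of the [k]-step probability of A is [nu' A] for every [k], while the integrand
   tends pointwise to [nu A] and is bounded by 1. Dominated convergence gives uniqueness among all
   probability measures. *)
- move=> nu' nu'Q A mA.
  have bA : bdd_meas (\1_A : Z -> R) by exact: bdd_meas_indic.
  have A01 w : `|\1_A w| <= 1 + U w :> R.
    rewrite indicE ger0_norm//.
    by rewrite (le_trans _ (_ : 1 <= _))// ?lern1 ?leq_b1// lerDl.
  have nu'T : nu' setT = 1%E by exact: probability_setT.
  pose I := \int[nu]_w \1_A w.
  have bk k := bdd_meas_kpow Q k bA.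
  have h1 k : measurable_fun setT (fun z => (\int[kpow Q k z]_w \1_A w)%:E).
    by apply/measurable_EFinP; case: (bk k).
  have h2 : measurable_fun setT (fun _ : Z => I%:E) by exact: measurable_cst.
  have h3 : {ae nu', forall z, setT z ->
      (\int[kpow Q k z]_w \1_A w)%:E @[k --> \oo] --> I%:E}.
    apply: aeW => z _; apply: cvg_EFin; first by apply: nearW.
    apply/cvgrPdist_lt => eps eps0.
    have /cvgrPdist_lt/(_ _ eps0)[N _ Ne] := rcvg' C (1 + U z + (U z0 + K')).
    exists N => // k /= Nk; rewrite distrC (le_lt_trans (conv z k _ bA A01))//.
    by have := Ne k Nk; rewrite sub0r normrN; apply: le_lt_trans; exact: ler_norm.
  have h4 : nu'.-integrable setT (fun _ : Z => 1%E : \bar R).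
    exact: (bdd_meas_integrable nu'T (bdd_meas_cst 1)).
  have h5 : {ae nu', forall z k, setT z ->
      (`|(\int[kpow Q k z]_w \1_A w)%:E| <= 1)%E}.
    apply: aeW => z k _; rewrite lee_fin ger0_norm.
      by apply: (bdd_int_le_cst (pkerT (kpow Q k) z) bA) => w; rewrite indicE lern1 leq_b1.
    by apply: (bdd_int_ge_cst (pkerT (kpow Q k) z) bA) => w; rewrite indicE.
  have [_ _] := dominated_convergence measurableT h1 h2 h3 h4 h5.
  rewrite (bdd_integralE nu'T (bdd_meas_cst I)) (prob_int_cst nu'T).
  rewrite (_ : [sequence _]_n = fun=> nu' A); last first.
    apply/funext => k /=; rewrite (bdd_integralE nu'T (bk k)).
    by rewrite stationary_kpow// -(prob_finE nu'T mA).
  move=> /(cvg_lim (@ereal_hausdorff R)); rewrite lim_cst; last exact: ereal_hausdorff.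
  by move=> ->; rewrite (prob_finE nuT mA).
- exists rho, (C * (1 + U z0 + K')); split => //.
    by rewrite mulr_gt0// -addrA ltr_pwDl// addr_ge0.
  move=> z k f bf fU; apply: (le_trans (conv z k f bf fU)).
  rewrite [leRHS](_ : _ = C * rho ^+ k * ((1 + U z0 + K') * (1 + U z))); last by lra.
  rewrite ler_wpM2l//; first by rewrite mulr_ge0 ?exprn_ge0// ltW.
  have : 0 <= (U z0 + K') * U z by rewrite mulr_ge0// addr_ge0.
  lra.
Qed.

End Harris_theorem.

(** * Borel sets and Lebesgue measure on R^n *)

Section box.
Context {R : realType} {n : nat}.

Definition box (a b : 'rV[R]_n) : set (Rd n) :=
  [set v | forall i, a ord0 i <= (v : 'rV[R]_n) ord0 i <= b ord0 i].

(** Rational corners make the family countable, so an open set is a countable union of boxes. *)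
Definition qbox (p : 'rV[rat]_n * 'rV[rat]_n) : set (Rd n) :=
  box (map_mx ratr p.1) (map_mx ratr p.2).

Lemma open_qboxE (A : set 'rV[R]_n) : open A ->
  A = \bigcup_(p in [set p | qbox p `<=` A]) qbox p.
Proof.
move=> oA; apply/seteqP; split; last by move=> x [p /= pA px]; exact: pA.
move=> x Ax; have : nbhs x A by exact: open_nbhs_nbhs.
move=> /nbhs_ballP[e /= e0 eA].
have Ha (i : 'I_n) : exists q : rat, x ord0 i - e < ratr q < x ord0 i.
  by have [|q] := @rat_in_itvoo R (x ord0 i - e) (x ord0 i);
    [rewrite ltrBlDr ltrDl|rewrite in_itv/= => ?; exists q].
have Hb (i : 'I_n) : exists q : rat, x ord0 i < ratr q < x ord0 i + e.
  by have [|q] := @rat_in_itvoo R (x ord0 i) (x ord0 i + e);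
    [rewrite ltrDl|rewrite in_itv/= => ?; exists q].
have [a aP] := choice Ha; have [b bP] := choice Hb.
exists (\row_i a i, \row_i b i) => /=.
  move=> v vab; apply: eA; split => // i j; rewrite ord1 /ball/= ltr_norml.
  have := vab j; rewrite !mxE; have := aP j; have := bP j.
  by move=> /andP[? ?] /andP[? ?] /andP[? ?]; apply/andP; split; lra.
move=> i; rewrite !mxE; have := aP i; have := bP i.
by move=> /andP[? ?] /andP[? ?]; apply/andP; split; lra.
Qed.

Lemma countable_bigcup_measurable d (T : measurableType d) (I : countType)
  (D : set I) (F : I -> set T) :
  (forall i, measurable (F i)) -> measurable (\bigcup_(i in D) F i).
Proof.
move=> mF; rewrite bigcup_mkcond.
pose G (k : nat) := if (choice.unpickle k : option I) is Some i
  then (if i \in D then F i else set0) else set0.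
rewrite (_ : \bigcup_i _ = \bigcup_k G k); rewrite /G.
  by apply: bigcupT_measurable => k; case: choice.unpickle => // i; case: ifP.
apply/seteqP; split => x [i _ Fx]; last first.
  by move: Fx; case: choice.unpickle => // j Fx; exists j.
by exists (choice.pickle i) => //; rewrite choice.pickleK.
Qed.

Lemma measurable_Rd_ge (i : 'I_n) (c : R) :
  measurable [set v : Rd n | c <= (v : 'rV[R]_n) ord0 i].
Proof.
rewrite -[X in measurable X]setCK; apply: measurableC; apply: sub_sigma_algebra.
rewrite (_ : ~` _ = (fun v : 'rV[R]_n => v ord0 i) @^-1` [set x | x < c]).
  by apply: open_comp (@open_lt R c) => v _; exact: coord_continuous.
by apply/seteqP; split => v /=; rewrite ltNge => /negP.
Qed.

Lemma measurable_coord (i : 'I_n) :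
  measurable_fun setT (fun v : Rd n => (v : 'rV[R]_n) ord0 i).
Proof.
apply: (measurability _ (RGenCInfty.measurableE R)) => _ [_ [c ->] <-].
rewrite setTI (_ : _ @^-1` _ = [set v : Rd n | c <= (v : 'rV[R]_n) ord0 i]).
  exact: measurable_Rd_ge.
by apply/seteqP; split => v /=; rewrite in_itv/= andbT.
Qed.

Lemma preimage_box d (T : measurableType d) (f : T -> 'rV[R]_n) (a b : 'rV[R]_n) :
  (forall i, measurable_fun setT (fun x => f x ord0 i)) ->
  measurable [set x | box a b (f x)].
Proof.
move=> mf; rewrite (_ : [set x | _] =
  \bigcap_(i in [set: 'I_n]) ((fun x => f x ord0 i) @^-1` `[a ord0 i, b ord0 i]%classic)).
  apply: fin_bigcap_measurable => // i _; rewrite -[X in measurable X]setTI.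
  by apply: mf => //; exact: measurable_itv.
by apply/seteqP; split => x /= h i; [move=> _|]; have := h i; rewrite /= in_itv/=; exact.
Qed.

Lemma measurable_box a b : measurable (box a b).
Proof.
have := @preimage_box _ (Rd n) (fun v => v) a b (fun i => measurable_coord i).
exact.
Qed.

Lemma measurable_to_Rd d (T : measurableType d) (f : T -> 'rV[R]_n) :
  (forall i, measurable_fun setT (fun x => f x ord0 i)) ->
  measurable_fun setT (f : T -> Rd n).
Proof.
move=> mf; apply: (@measurability _ _ T (Rd n) setT f (@open 'rV[R]_n)) => //.
move=> _ [A oA <-]; rewrite setTI (open_qboxE oA) preimage_bigcup.
by apply: countable_bigcup_measurable => p; exact: preimage_box.
Qed.

(** Boxes are the sets on which [leb] is prescribed; as generators they allow measures to be
    compared on boxes alone. *)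
Lemma Rd_measurableE : @measurable _ (Rd n) = <<s [set A | exists a b, A = box a b] >>.
Proof.
apply/seteqP; split.
  apply: smallest_sub; first exact: smallest_sigma_algebra.
  move=> A oA; rewrite (open_qboxE oA).
  apply: (@countable_bigcup_measurable _
    (g_sigma_algebraType [set A : set (Rd n) | exists a b, A = box a b])) => p.
  by apply: sub_sigma_algebra; exists (map_mx ratr p.1), (map_mx ratr p.2).
apply: smallest_sub; first exact: sigma_algebra_measurable.
by move=> _ [a [b ->]]; exact: measurable_box.
Qed.

Variable leb : {measure set (@Rd R n) -> \bar R}.
Hypothesis lebE : forall a b : 'rV[R]_n, (forall i, a ord0 i <= b ord0 i) ->
  leb (box a b) = (\prod_(i < n) (b ord0 i - a ord0 i))%:E.

Definition translate (c : 'rV[R]_n) (v : Rd n) : Rd n := (v : 'rV[R]_n) + c.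

Lemma measurable_translate c : measurable_fun setT (translate c).
Proof.
apply: measurable_to_Rd => i; under eq_fun do rewrite /translate mxE.
by apply: measurable_funD => //; exact: measurable_coord.
Qed.

(** The pushforward agrees with [leb] on boxes, which are stable under intersection, generate the
    Borel sets and contain an exhausting sequence of cubes of finite measure; uniqueness of measures
    concludes. *)
Lemma leb_translate (c : 'rV[R]_n) (A : set (Rd n)) : measurable A ->
  leb (translate c @^-1` A) = leb A.
Proof.
move=> mA.
pose g k : set (Rd n) := box (const_mx (- k%:R)) (const_mx k%:R).
pose G : set (set (Rd n)) := [set A | exists a b, A = box a b].
have [mu' mu'E] : exists mu' : {measure set (Rd n) -> \bar R},
    mu' = pushforward leb (translate c) :> (set _ -> _).
  by exists (measure_function_pushforward__canonical__measure_function_Measure leb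
    (measurable_translate c)).
have m12 B : G B -> leb B = mu' B.
  rewrite mu'E.
  move=> [a [b ->]].
  have pE : translate c @^-1` box a b = box (a - c) (b - c).
    by apply/seteqP; split => v /= h i; have := h i; rewrite /translate !mxE;
      move=> /andP[? ?]; apply/andP; split; lra.
  rewrite /pushforward pE.
  (* [lebE] speaks of ordered corners only; with a reversed pair the box and its translate are both
     empty. *)
  have [ab|/existsNP[i /negP]] := pselect (forall i, a ord0 i <= b ord0 i).
    rewrite !lebE//; last by move=> i; rewrite !mxE lerD2r.
    by congr EFin; apply: eq_bigr => i _; rewrite !mxE; lra.
  rewrite -ltNge => ba.
  have -> : box a b = set0.
    by apply/seteqP; split => // v /(_ i)/andP[h1 h2]; have := le_trans h1 h2; rewrite leNgt ba.
  suff -> : box (a - c) (b - c) = set0 by rewrite !measure0.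
  by apply/seteqP; split => // v /(_ i)/andP[h1 h2]; have := le_trans h1 h2;
    rewrite leNgt !mxE ltrD2r ba.
have GI : setI_closed G.
  move=> _ _ [a [b ->]] [a' [b' ->]].
  exists (\row_i Num.max (a ord0 i) (a' ord0 i)), (\row_i Num.min (b ord0 i) (b' ord0 i)).
  apply/seteqP; split => [v [h1 h2] i|v h].
    have /andP[p1 p2] := h1 i; have /andP[p3 p4] := h2 i; rewrite !mxE.
    by apply/andP; split; [rewrite ge_max|rewrite le_min]; apply/andP; split.
  split => i; have := h i; rewrite !mxE ge_max le_min => /andP[/andP[p1 p2] /andP[p3 p4]];
    by apply/andP; split.
have Gg k : G (g k) by exists (const_mx (- k%:R)), (const_mx k%:R).
have gT : \bigcup_k (g k) = setT.
  apply/seteqP; split => // v _.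
  pose k := \max_(i < n) Num.bound `|(v : 'rV[R]_n) ord0 i|.
  exists k => // i; rewrite !mxE -ler_norml; apply: ltW.
  rewrite (lt_le_trans (archi_boundP _))// ler_nat.
  exact: (leq_bigmax (F := fun i => Num.bound `|(v : 'rV[R]_n) ord0 i|)).
have gfin k : (leb (g k) < +oo)%E.
  by rewrite lebE ?ltry// => i; rewrite !mxE; have := ler0n R k; lra.
by rewrite (measure_unique G g Rd_measurableE GI Gg gT leb mu' m12 gfin _ mA) mu'E.
Qed.

End box.

(** * Euclidean norm and centered noise *)

Section euclidean.
Context {R : realType} {n : nat}.
Implicit Types u v w : 'rV[R]_n.

Lemma dotvC u v : dotv u v = dotv v u.
Proof. by apply: eq_bigr => i _; rewrite mulrC. Qed.

Lemma dotvDl u v w : dotv (u + v) w = dotv u w + dotv v w.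
Proof. by rewrite -big_split; apply: eq_bigr => i _; rewrite mxE mulrDl. Qed.

Lemma dotvZl (c : R) u v : dotv (c *: u) v = c * dotv u v.
Proof. by rewrite mulr_sumr; apply: eq_bigr => i _; rewrite mxE mulrA. Qed.

Lemma dotvDr u v w : dotv w (u + v) = dotv w u + dotv w v.
Proof. by rewrite dotvC dotvDl !(dotvC _ w). Qed.

Lemma dotvZr (c : R) u v : dotv v (c *: u) = c * dotv v u.
Proof. by rewrite dotvC dotvZl dotvC. Qed.

Lemma dotvv_ge0 u : 0 <= dotv u u.
Proof. by apply: sumr_ge0 => i _; rewrite -expr2 sqr_ge0. Qed.

Lemma vnorm_ge0 u : 0 <= vnorm u.
Proof. exact: sqrtr_ge0. Qed.

Lemma vnorm_sqr u : vnorm u ^+ 2 = dotv u u.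
Proof. by rewrite sqr_sqrtr// dotvv_ge0. Qed.

Lemma coord_le_vnorm u i : `|u ord0 i| <= vnorm u.
Proof.
rewrite -sqrtr_sqr ler_sqrt ?dotvv_ge0// /dotv (bigD1 i)//= expr2 lerDl.
by apply: sumr_ge0 => j _; rewrite -expr2 sqr_ge0.
Qed.

(** Cauchy-Schwarz: the squared norm of u - t v is evaluated at its minimum t = b / c; when [c = 0]
    the vector [v] vanishes. *)
Lemma dotv_le u v : `|dotv u v| <= vnorm u * vnorm v.
Proof.
rewrite -ler_sqr ?nnegrE ?mulr_ge0 ?vnorm_ge0// exprMn !vnorm_sqr real_normK ?num_real//.
set a := dotv u u; set b := dotv u v; set c := dotv v v.
have E t : 0 <= a - 2 * t * b + t ^+ 2 * c.
  have := dotvv_ge0 (u + (- t) *: v).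
  by rewrite dotvDl !dotvDr !dotvZl !dotvZr (dotvC v u) -/a -/b -/c; nra.
have c0 : 0 <= c by exact: dotvv_ge0.
have [c0'|cn0] := eqVneq c 0; last first.
  have cp : 0 < c by rewrite lt_def cn0.
  have := mulr_ge0 (E (b / c)) (ltW cp).
  have -> : (a - 2 * (b / c) * b + (b / c) ^+ 2 * c) * c = a * c - b ^+ 2 by field.
  by lra.
have v0 i : v ord0 i = 0.
  apply/eqP; rewrite -normr_le0 (le_trans (coord_le_vnorm v i))//.
  by rewrite /vnorm -/c c0' sqrtr0.
rewrite /b /dotv big1 ?expr0n ?mulr_ge0//; first exact: dotvv_ge0.
by move=> i _; rewrite v0 mulr0.
Qed.

Lemma vnormD u v : vnorm (u + v) <= vnorm u + vnorm v.
Proof.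
rewrite -ler_sqr ?nnegrE ?addr_ge0 ?vnorm_ge0// sqrrD !vnorm_sqr.
rewrite dotvDl !dotvDr (dotvC v u).
by have := dotv_le u v; rewrite ler_norml => /andP[_]; lra.
Qed.

Lemma vnorm_sqrDZ (c : R) u v :
  vnorm (u + c *: v) ^+ 2 = vnorm u ^+ 2 + 2 * c * dotv u v + c ^+ 2 * vnorm v ^+ 2.
Proof. by rewrite !vnorm_sqr dotvDl !dotvDr !dotvZl !dotvZr (dotvC v); ring. Qed.

Lemma vnormZ (c : R) u : vnorm (c *: u) = `|c| * vnorm u.
Proof.
by rewrite /vnorm dotvZl dotvZr mulrA -expr2 sqrtrM ?sqr_ge0// sqrtr_sqr.
Qed.

Lemma measurable_dotv d (T : measurableType d) (f h : T -> 'rV[R]_n) :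
  (forall i, measurable_fun setT (fun x => f x ord0 i)) ->
  (forall i, measurable_fun setT (fun x => h x ord0 i)) ->
  measurable_fun setT (fun x => dotv (f x) (h x)).
Proof.
move=> mf mh; apply: (@measurable_sum _ _ _ _ _ _ (fun i x => f x ord0 i * h x ord0 i)) => i.
exact: measurable_funM.
Qed.

End euclidean.

(** The bound may vary with the parameter [x], as it must for an integrand growing quadratically in
    [theta]; raising [f] by [B x] makes it nonnegative. *)
Lemma measurable_param_int d1 d2 (X : measurableType d1) (Y : measurableType d2)
    (R : realType) (l : R.-pker X ~> Y) (f : X * Y -> R) (B : X -> R) :
  measurable_fun setT f -> measurable_fun setT B -> (forall x y, `|f (x, y)| <= B x) ->
  measurable_fun setT (fun x => \int[l x]_y f (x, y)).
Proof.
move=> mf mB fB.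
have bf x : bdd_meas (fun y => f (x, y)).
  by split; [exact: measurableT_comp mf (pair1_measurable x)|exists (B x)].
rewrite (_ : (fun x => _) =
    fun x => fine (\int[l x]_y ((f (x, y) + B x)%:E))%E - B x).
  apply: measurable_funB => //; apply: measurableT_comp => //.
  apply: (measurable_fun_integral_sfinite_kernel (fun w => (f w + B w.1)%:E) l).
    by move=> [x y]; rewrite lee_fin -lerBlDr sub0r; have := fB x y; rewrite ler_norml => /andP[].
  apply/measurable_EFinP; apply: measurable_funD => //.
  exact: measurableT_comp mB measurable_fst.
apply/funext => x; rewrite -/(Rintegral _ _ (fun y => f (x, y) + B x)).
rewrite (bdd_intD (pkerT l x))//; last exact: bdd_meas_cst.
by rewrite (prob_int_cst (pkerT l x)) addrK.
Qed.

Section centered_noise.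
Context {R : realType} {n : nat}.
Variable m : {measure set (@Rd R n) -> \bar R}.
Variable s : R.
Hypothesis m1 : m setT = 1%E.
Hypothesis m0 : forall i : 'I_n, (\int[m]_t ((t : 'rV[R]_n) ord0 i)%:E = 0)%E.
Hypothesis ms : (\int[m]_t (vnorm (t : 'rV[R]_n) ^+ 2)%:E <= s%:E)%E.

Lemma measurable_vnorm2 : measurable_fun setT (fun t : @Rd R n => vnorm (t : 'rV[R]_n) ^+ 2).
Proof.
under eq_fun do rewrite vnorm_sqr.
by apply: measurable_dotv; exact: measurable_coord.
Qed.

Lemma noise_integrable2 : m.-integrable setT (fun t => (vnorm (t : 'rV[R]_n) ^+ 2)%:E).
Proof.
apply/integrableP; split; first by apply/measurable_EFinP; exact: measurable_vnorm2.
under eq_integral do rewrite gee0_abs ?lee_fin ?sqr_ge0//.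
by rewrite (le_lt_trans ms) ?ltry.
Qed.

Lemma noise_integrable1 i : m.-integrable setT (fun t => ((t : 'rV[R]_n) ord0 i)%:E).
Proof.
have i1 : m.-integrable setT (fun t : @Rd R n => (1 : R)%:E).
  exact: (bdd_meas_integrable m1 (bdd_meas_cst 1)).
have h := integrableD measurableT i1 noise_integrable2.
apply: (le_integrable measurableT _ _ h).
  by apply/measurable_EFinP; exact: measurable_coord.
move=> t _ /=; rewrite lee_fin.
have h2 := coord_le_vnorm (t : 'rV[R]_n) i; have h1 := vnorm_ge0 (t : 'rV[R]_n).
rewrite [leRHS]ger0_norm ?addr_ge0 ?sqr_ge0//.
by rewrite (le_trans h2)//; have := sqr_ge0 (vnorm (t : 'rV[R]_n) - 1); nra.
Qed.

(** The second moment bound makes the coordinates integrable, and centering removes the linear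
    term. *)
Lemma noise_quadratic_le (c0 c1 : R) (w : 'rV[R]_n) : 0 <= c1 ->
  (\int[m]_t (c0 + dotv w (t : 'rV[R]_n) + c1 * vnorm (t : 'rV[R]_n) ^+ 2)%:E
    <= (c0 + c1 * s)%:E)%E.
Proof.
move=> c10.
have i0 : m.-integrable setT (fun t : @Rd R n => c0%:E).
  exact: (bdd_meas_integrable m1 (bdd_meas_cst c0)).
have iw i : m.-integrable setT (fun t => (w ord0 i * (t : 'rV[R]_n) ord0 i)%:E).
  exact: (integrableZl measurableT (w ord0 i) (noise_integrable1 i)).
have iW : m.-integrable setT (fun t => (dotv w (t : 'rV[R]_n))%:E).
  rewrite /dotv; under eq_fun do rewrite -sumEFin.
  by apply: integrable_sum => // i _.
have i2 : m.-integrable setT (fun t => (c1 * vnorm (t : 'rV[R]_n) ^+ 2)%:E).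
  exact: (integrableZl measurableT c1 noise_integrable2).
have i01 := integrableD measurableT i0 iW.
rewrite (integralD measurableT i01 i2) (integralD measurableT i0 iW) integral_cst// m1 mule1.
have -> : (\int[m]_t (dotv w (t : 'rV[R]_n))%:E = 0)%E.
  rewrite /dotv; under eq_integral do rewrite -sumEFin.
  rewrite integral_sum//= big1// => i _.
  by under eq_integral do rewrite EFinM; rewrite integralZl ?m0 ?mule0//; exact: noise_integrable1.
rewrite adde0 EFinD leeD2l//.
under eq_integral do rewrite EFinM.
rewrite integralZl//; last exact: noise_integrable2.
by rewrite EFinM lee_wpmul2l.
Qed.

End centered_noise.

(** * The stochastic approximation chain and its drift *)

Section SA_chain.
Context {d} {X : measurableType d} {R : realType} {n : nat}.
Variables (P : R.-pker X ~> X) (zeta : R.-pker (@Rd R n) ~> (@Rd R n)).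
Variables (g : 'rV[R]_n -> X -> 'rV[R]_n) (alpha : R).

Local Notation Z := (X * @Rd R n)%type.

Definition SA_step (w : (Z * X) * @Rd R n) : Z :=
  (w.1.2, (w.1.1.2 : 'rV[R]_n) + alpha *: (g w.1.1.2 w.1.1.1 + (w.2 : 'rV[R]_n))).

Hypothesis mg : forall i, measurable_fun setT (fun z : Z => g z.2 z.1 ord0 i).

Lemma measurable_SA_step : measurable_fun setT SA_step.
Proof.
apply: measurable_fun_pair.
  exact: measurableT_comp measurable_snd measurable_fst.
apply: measurable_to_Rd => i; under eq_fun do rewrite !mxE.
have m11 : measurable_fun setT (fun w : (Z * X) * @Rd R n => w.1.1).
  exact: measurableT_comp measurable_fst measurable_fst.
apply: measurable_funD; last apply: measurable_funM; [|by []|apply: measurable_funD].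
- exact: measurableT_comp (measurable_coord i) (measurableT_comp measurable_snd m11).
- exact: measurableT_comp (mg i) m11.
- exact: measurableT_comp (measurable_coord i) measurable_snd.
Qed.

(** A transition is decomposed in the order of [SA_kernel]: the new state [x'], then the noise, then
    the update as a Dirac kernel. Kernel composition supplies measurability and mass one. *)
Definition SA_noise : R.-pker (Z * X)%type ~> Z :=
  pkcomp (kpullback zeta (measurableT_comp measurable_snd measurable_fst))
         (kdirac measurable_SA_step).

Definition SA_ker : R.-pker Z ~> Z := pkcomp (kpullback P measurable_fst) SA_noise.

Lemma SA_kernelE :
  SA_kernel (fun x A => P x A) (fun t A => zeta t A) g alpha = fun z A => SA_ker z A.
Proof.
apply/funext => z; apply/funext => A; apply: eq_integral => x' _.
by apply: eq_integral => t _; rewrite /kdirac/= diracE.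
Qed.

Lemma ge0_int_SA_noise (f : Z -> \bar R) z x' :
  (forall w, (0 <= f w)%E) -> measurable_fun setT f ->
  (\int[SA_noise (z, x')]_w f w = \int[zeta z.2]_t f (SA_step ((z, x'), t)))%E.
Proof.
move=> f0 mf; transitivity
  (\int[zeta z.2]_t \int[kdirac (R := R) measurable_SA_step ((z, x'), t)]_w f w)%E.
  exact: (@integral_kcomp _ _ _ _ _ _ _
    (kpullback zeta (measurableT_comp measurable_snd measurable_fst))
    (kdirac measurable_SA_step)).
by apply: eq_integral => t _; rewrite /kdirac/= integral_dirac// diracT mul1e.
Qed.

Lemma ge0_int_SA_ker (f : Z -> \bar R) z :
  (forall w, (0 <= f w)%E) -> measurable_fun setT f ->
  (\int[SA_ker z]_w f w = \int[P z.1]_x' \int[SA_noise (z, x')]_w f w)%E.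
Proof.
by move=> f0 mf; exact: (@integral_kcomp _ _ _ _ _ _ _ (kpullback P measurable_fst) SA_noise).
Qed.

(** The first coordinate is itself a chain driven by [P]: a function of [x'] is constant under the
    noise integral. *)
Lemma SA_kpow_fst k z (f : X -> R) : bdd_meas f ->
  \int[kpow SA_ker k z]_w f w.1 = \int[kpow P k z.1]_x f x.
Proof.
have bfst (h : X -> R) : bdd_meas h -> bdd_meas (fun w : Z => h w.1).
  move=> [mh [M hM]]; split; last by exists M.
  exact: measurableT_comp mh measurable_fst.
elim: k f => [|k IH] f bf; first by rewrite !bdd_int_kpow0//; exact: bfst.
rewrite bdd_int_kpowS ?bdd_int_kpowS//; last exact: bfst.
rewrite -IH; last exact: bdd_meas_int_kernel.
apply: eq_Rintegral => w _; rewrite bdd_int_pkcomp; last exact: bfst.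
apply: eq_Rintegral => x' _; rewrite bdd_int_pkcomp; last exact: bfst.
rewrite -[RHS](prob_int_cst (pkerT zeta w.2) (f x')); apply: eq_Rintegral => t _.
have [mf _] := bfst f bf.
rewrite /Rintegral /kdirac integral_dirac//; last exact/measurable_EFinP.
by rewrite diracT mul1e.
Qed.

(** * The perturbed Lyapunov function *)

Section drift.
Variables (pi : probability X R) (thstar : 'rV[R]_n) (mu L1 L2 : R) (tau : nat).
Hypothesis alpha0 : 0 < alpha.
Hypothesis tau1 : (1 <= tau)%N.
Hypothesis tauP : forall x A, measurable A ->
  (`| kiter (fun x A => P x A) tau x A - pi A | <= alpha%:E)%E.
Hypothesis L10 : 0 < L1.
Hypothesis gL : forall x t t', vnorm (g t x - g t' x) <= L1 * vnorm (t - t').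
Hypothesis gB : forall t x, vnorm (g t x) <= L1 * (vnorm (t - thstar) + 1).
Hypothesis mu0 : 0 < mu.
Hypothesis gmono : forall t t', dotv (t - t') (gbar pi g t - gbar pi g t')
     <= - mu * vnorm (t - t') ^+ 2.
Hypothesis gstar : gbar pi g thstar = 0.
Hypothesis mu1 : mu <= 1.
Hypothesis zeta0 : forall (t : 'rV[R]_n) (i : 'I_n),
  (\int[zeta t]_s ((s : 'rV[R]_n) ord0 i)%:E = 0)%E.
Hypothesis L20 : 0 <= L2.
Hypothesis zeta2 : forall t : 'rV[R]_n, (\int[zeta t]_s (vnorm (s : 'rV[R]_n) ^+ 2)%:E
     <= ((L2 * (vnorm (t - thstar) + 1)) ^+ 2)%:E)%E.
Hypothesis L1L2 : 1 <= L1 + L2.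
Hypothesis step : alpha * tau%:R * (L1 + L2) ^+ 2 < mu / 72.

Let nm (t : 'rV[R]_n) := vnorm (t - thstar).
Let phi (t : 'rV[R]_n) (x : X) := dotv (t - thstar) (g t x).

Lemma measurable_SA_phi : measurable_fun setT (fun z : Z => phi z.2 z.1).
Proof.
apply: measurable_dotv => // i; under eq_fun do rewrite !mxE.
apply: measurable_funB => //.
exact: measurableT_comp (measurable_coord i) measurable_snd.
Qed.

Lemma measurable_SA_norm : measurable_fun setT (fun z : Z => nm z.2).
Proof.
rewrite /nm /vnorm; apply: measurableT_comp => //.
  by apply: continuous_measurable_fun; exact: sqrt_continuous.
have mi (i : 'I_n) : measurable_fun setT (fun z : Z => ((z.2 : 'rV[R]_n) - thstar) ord0 i).
  under eq_fun do rewrite !mxE; apply: measurable_funB => //.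
  exact: measurableT_comp (measurable_coord i) measurable_snd.
exact: measurable_dotv.
Qed.

Let phiB t x : `|phi t x| <= L1 * (nm t * (nm t + 1)).
Proof.
rewrite (le_trans (dotv_le _ _))// mulrCA ler_wpM2l ?vnorm_ge0//.
Qed.

Let bdd_phi t : bdd_meas (phi t).
Proof.
split; last by eexists => x; exact: phiB.
exact: measurableT_comp measurable_SA_phi (pair2_measurable (t : @Rd R n)).
Qed.

(* The truncated solution of the Poisson equation for [phi t - pi(phi t)]. *)
Definition SA_corr (x : X) (t : 'rV[R]_n) : R :=
  \sum_(k < tau) (\int[kpow P k x]_y phi t y - \int[pi]_y phi t y).

(** With the summand 1 the correction is at most half of the rest, so the function is comparable
    with [V] and nonnegative, as required of a drift function. *)
Definition SA_lyap (z : Z) : R := 1 + nm z.2 ^+ 2 + 2 * alpha * SA_corr z.1 z.2.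

Let pi1 : pi setT = 1%E. Proof. exact: probability_setT. Qed.

Lemma measurable_SA_lyap : measurable_fun setT SA_lyap.
Proof.
have mB : measurable_fun setT (fun z : Z => L1 * (nm z.2 * (nm z.2 + 1))).
  do 2 (apply: measurable_funM => //).
  - exact: measurable_SA_norm.
  - by apply: measurable_funD => //; exact: measurable_SA_norm.
have mp : measurable_fun setT (fun w : Z * X => phi w.1.2 w.2).
  apply: (measurableT_comp measurable_SA_phi (g := fun w : Z * X => (w.2, w.1.2))).
  apply: measurable_fun_pair => //.
  exact: measurableT_comp measurable_snd measurable_fst.
apply: measurable_funD; last apply: measurable_funM => //.
  by apply: measurable_funD => //; apply: measurable_funX; exact: measurable_SA_norm.
rewrite /SA_corr; apply: (@measurable_sum _ _ _ _ _ _ (fun k (z : Z) =>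
  \int[kpow P (nat_of_ord k) z.1]_y phi z.2 y - \int[pi]_y phi z.2 y)) => k.
apply: measurable_funB.
- apply: (measurable_param_int (kpullback (kpow P k) measurable_fst) mp mB) => z x.
  exact: phiB.
- apply: (measurable_param_int (kconst pi : R.-pker Z ~> X) mp mB) => z x.
  exact: phiB.
Qed.

Let int_le_phi (m : {measure set X -> \bar R}) t : m setT = 1%E ->
  `|\int[m]_y phi t y| <= L1 * (nm t * (nm t + 1)).
Proof.
move=> m1; have h y := phiB t y; rewrite ler_norml; apply/andP; split.
- by apply: bdd_int_ge_cst => // y; have := h y; rewrite ler_norml => /andP[].
- by apply: bdd_int_le_cst => // y; have := h y; rewrite ler_norml => /andP[].
Qed.

Let corrB x t : `|SA_corr x t| <= tau%:R * (2 * (L1 * (nm t * (nm t + 1)))).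
Proof.
rewrite (le_trans (ler_norm_sum _ _ _))// -[tau in leRHS]card_ord -sumr_const mulr_suml.
apply: ler_sum => k _; rewrite mul1r (le_trans (ler_normB _ _))//.
have := int_le_phi t (pkerT (kpow P k) x); have := int_le_phi t pi1.
by lra.
Qed.

Let L := L1 + L2.
Let t1 : 1 <= tau%:R :> R. Proof. by rewrite ler1n. Qed.

(** As L >= 1 and mu <= 1, the condition on alpha tau L^2 also bounds alpha tau L by an absolute
    constant. *)
Let atL : alpha * tau%:R * L <= 1 / 72 :> R.
Proof.
have h : 0 <= alpha * tau%:R * L.
  by rewrite !mulr_ge0 ?(ltW alpha0)//; exact: le_trans ler01 L1L2.
have : alpha * tau%:R * L * 1 <= alpha * tau%:R * L * L by rewrite ler_wpM2l.
have := step; rewrite -/L; have := mu1; have : L ^+ 2 = L * L by rewrite expr2.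
by move=> ->; rewrite mulrA; lra.
Qed.

Let aL : alpha * L1 <= 1.
Proof.
have h : 0 <= alpha * L1 by rewrite mulr_ge0// ltW.
have : alpha * L1 * 1 <= alpha * L1 * tau%:R by rewrite ler_wpM2l.
have h2 : 0 <= alpha * tau%:R * L2 by rewrite !mulr_ge0// ltW.
by move: atL; rewrite /L; nra.
Qed.

Lemma SA_lyap_corr z : `|2 * alpha * SA_corr z.1 z.2| <= (nm z.2 ^+ 2 + 1) / 2.
Proof.
have a0 : 0 <= nm z.2 by exact: vnorm_ge0.
have h := corrB z.1 z.2.
rewrite normrM ger0_norm; last by rewrite mulr_ge0// ltW.
apply: (@le_trans _ _ (2 * alpha * (tau%:R * (2 * (L1 * (nm z.2 * (nm z.2 + 1))))))).
  by rewrite ler_wpM2l// mulr_ge0// ltW.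
rewrite [leLHS](_ : _ = 4 * (alpha * tau%:R * L1) * (nm z.2 * (nm z.2 + 1))); last by ring.
have h1 : alpha * tau%:R * L1 <= 1 / 72.
  apply: le_trans atL; rewrite ler_wpM2l// ?/L ?lerDl//.
  by rewrite mulr_ge0// ltW.
have h0 : 0 <= alpha * tau%:R * L1 by rewrite !mulr_ge0// ltW.
have h2 : nm z.2 * (nm z.2 + 1) <= 3 / 2 * (nm z.2 ^+ 2 + 1).
  by have := sqr_ge0 (nm z.2 - 1); nra.
have h3 : 0 <= nm z.2 * (nm z.2 + 1) by rewrite mulr_ge0// addr_ge0.
nra.
Qed.

Lemma SA_lyap_bounds z :
  (nm z.2 ^+ 2 + 1) / 2 <= SA_lyap z <= 3 / 2 * (nm z.2 ^+ 2 + 1).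
Proof.
have := SA_lyap_corr z; rewrite /SA_lyap ler_norml => /andP[h1 h2].
by apply/andP; split; lra.
Qed.

(** Applying [P] shifts the summation index by one, so the sum telescopes: the term of index 0
    leaves, the one of index [tau] enters, and the stationary means cancel. *)
Lemma SA_corr_step x t :
  \int[P x]_x' SA_corr x' t = SA_corr x t - phi t x + \int[kpow P tau x]_y phi t y.
Proof.
pose a k := \int[kpow P k x]_y phi t y.
have bk k : bdd_meas (fun x' => \int[kpow P k x']_y phi t y) by exact: bdd_meas_kpow.
rewrite /SA_corr (@bdd_int_sum _ _ _ _ (pkerT P x) _ _ (fun (k : 'I_tau) x' =>
  \int[kpow P k x']_y phi t y - \int[pi]_y phi t y)); last first.
  by move=> k; apply: bdd_measB => //; exact: bdd_meas_cst.
have -> : phi t x = a 0%N by rewrite /a bdd_int_kpow0.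
have -> : \int[kpow P tau x]_y phi t y =
    a 0%N + \sum_(k < tau) (a k.+1 - a k).
  by rewrite -(big_mkord xpredT (fun k => a k.+1 - a k)) telescope_sumr// addrC subrK.
rewrite addrA addrNK -big_split; apply: eq_bigr => k _.
rewrite (bdd_intB (pkerT P x))//; last exact: bdd_meas_cst.
rewrite (prob_int_cst (pkerT P x)) -(bdd_int_kpow1 P x (bk k)) -bdd_int_kpowD// add1n.
by rewrite /a /=; lra.
Qed.

Lemma SA_mean_phi t : \int[pi]_y phi t y <= - mu * nm t ^+ 2.
Proof.
have := gmono t thstar; rewrite gstar subr0; apply: le_trans.
have bg i : bdd_meas (fun y => g t y ord0 i).
  split; last first.
    by eexists => y; apply: le_trans (coord_le_vnorm _ _) (gB t y).
  exact: measurableT_comp (mg i) (pair2_measurable (t : @Rd R n)).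
rewrite /phi /dotv (bdd_int_sum pi1); last by move=> i; exact: bdd_measZ.
by apply: ler_sum => i _; rewrite (bdd_intZ pi1)// [gbar _ _ _ _ _]mxE.
Qed.

Let phi_step t (eta : 'rV[R]_n) y :
  `|phi (t + alpha *: eta) y - phi t y| <=
  alpha * L1 * vnorm eta * (2 * nm t + 1) + alpha ^+ 2 * L1 * vnorm eta ^+ 2.
Proof.
pose t' := t + alpha *: eta; rewrite -/t'.
have e0 := vnorm_ge0 eta; have a0 : 0 <= nm t by exact: vnorm_ge0.
have dE : t' - t = alpha *: eta by rewrite /t' addrAC subrr add0r.
have dn : vnorm (t' - t) = alpha * vnorm eta by rewrite dE vnormZ ger0_norm// ltW.
have nt' : nm t' <= nm t + alpha * vnorm eta.
  have E : t' - thstar = (t' - t) + (t - thstar) by rewrite addrA subrK.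
  by rewrite -dn /nm E addrC vnormD.
have -> : phi t' y - phi t y = dotv (t' - t) (g t' y) + dotv (t - thstar) (g t' y - g t y).
  rewrite /phi dotvDr -[- g t y]scaleN1r dotvZr mulN1r addrA; congr (_ - _).
  by rewrite -dotvDl addrA subrK.
rewrite (le_trans (ler_normD _ _))//.
have h1 := le_trans (dotv_le (t' - t) (g t' y)) (ler_wpM2l (vnorm_ge0 _) (gB t' y)).
have h2 := le_trans (dotv_le (t - thstar) (g t' y - g t y)) (ler_wpM2l (vnorm_ge0 _) (gL y t' t)).
rewrite dn in h1 h2; rewrite -/(nm t') in h1; rewrite -/(nm t) in h2.
have h3 : alpha * vnorm eta * (L1 * (nm t' + 1)) <=
    alpha * vnorm eta * (L1 * (nm t + alpha * vnorm eta + 1)).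
  by rewrite ler_wpM2l ?mulr_ge0 ?(ltW alpha0)// ler_wpM2l ?(ltW L10)// lerD2r.
rewrite [leRHS](_ : _ = alpha * vnorm eta * (L1 * (nm t + alpha * vnorm eta + 1)) +
  nm t * (L1 * (alpha * vnorm eta))); last by ring.
by apply: lerD => //; exact: le_trans h1 h3.
Qed.

(** The increment of phi contains the mixed term L1 |eta| (2 nm + 1), split by Young's inequality,
    with (2 nm + 1)^2 <= 8 (nm^2 + 1); the quadratic term is reduced by alpha L1 <= 1. The factor 2
    counts the chain mean and the stationary mean in each summand. *)
Let corr_step x t (eta : 'rV[R]_n) :
  SA_corr x (t + alpha *: eta) <= SA_corr x t + tau%:R * (2 * (alpha *
    (3 / 2 * vnorm eta ^+ 2 + 4 * L ^+ 2 * (nm t ^+ 2 + 1)))).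
Proof.
set D := alpha * _; pose t' := t + alpha *: eta; rewrite -/t'.
have e0 := vnorm_ge0 eta; have a0 : 0 <= nm t by exact: vnorm_ge0.
have LL1 : L1 <= L by rewrite /L lerDl.
have D1 y : `|phi t' y - phi t y| <= D.
  apply: (le_trans (phi_step t eta y)).
  have h1 : alpha ^+ 2 * L1 * vnorm eta ^+ 2 <= alpha * vnorm eta ^+ 2.
    rewrite ler_wpM2r ?sqr_ge0// expr2 -mulrA ler_piMr// ltW//.
  have h2 : L1 * vnorm eta * (2 * nm t + 1) <=
      vnorm eta ^+ 2 / 2 + L1 ^+ 2 * (2 * nm t + 1) ^+ 2 / 2.
    by have := sqr_ge0 (vnorm eta - L1 * (2 * nm t + 1)); lra.
  have h3 : L1 ^+ 2 * (2 * nm t + 1) ^+ 2 <= L ^+ 2 * (8 * (nm t ^+ 2 + 1)).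
    apply: ler_pM; rewrite ?sqr_ge0//.
      by rewrite lerXn2r ?nnegrE ?(ltW L10)// (le_trans _ LL1)// ltW.
    by have := sqr_ge0 (2 * nm t - 1); lra.
  have h4 : alpha * (L1 * vnorm eta * (2 * nm t + 1)) <=
      alpha * (vnorm eta ^+ 2 / 2 + L ^+ 2 * (8 * (nm t ^+ 2 + 1)) / 2).
    by rewrite ler_wpM2l ?(ltW alpha0)//; lra.
  by rewrite /D; lra.
have int_diff (m : {measure set X -> \bar R}) : m setT = 1%E ->
    `|\int[m]_y phi t' y - \int[m]_y phi t y| <= D.
  move=> m1; rewrite -(bdd_intB m1)//.
  have b := bdd_measB (bdd_phi t') (bdd_phi t).
  rewrite ler_norml; apply/andP; split.
  - by apply: bdd_int_ge_cst => // y; have := D1 y; rewrite ler_norml => /andP[].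
  - by apply: bdd_int_le_cst => // y; have := D1 y; rewrite ler_norml => /andP[].
rewrite -lerBlDl /SA_corr -sumrB -[tau in leRHS]card_ord -sumr_const mulr_suml.
apply: ler_sum => k _; rewrite mul1r.
have := int_diff _ (pkerT (kpow P k) x); have := int_diff _ pi1.
by rewrite !ler_norml => /andP[? ?] /andP[? ?]; lra.
Qed.

(** Coefficient of |eta|^2: alpha^2 from expanding the square, and 2 alpha tau 2 alpha 3/2 from
    [corr_step]. *)
Let c1 := alpha ^+ 2 + 6 * alpha ^+ 2 * tau%:R.

(** The bound is a polynomial of degree two in the noise, the shape that [noise_quadratic_le]
    integrates; the correction is left at the new [x'] but at the old [theta]. *)
Let lyap_step z x' (s : 'rV[R]_n) :
  SA_lyap (SA_step ((z, x'), s)) <=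
  (1 + nm z.2 ^+ 2 + 2 * alpha * phi z.2 z.1 + c1 * vnorm (g z.2 z.1) ^+ 2 +
   16 * alpha ^+ 2 * tau%:R * L ^+ 2 * (nm z.2 ^+ 2 + 1) + 2 * alpha * SA_corr x' z.2) +
  dotv ((2 * alpha) *: ((z.2 : 'rV[R]_n) - thstar) + (2 * c1) *: g z.2 z.1) s +
  c1 * vnorm s ^+ 2.
Proof.
case: z => x t; rewrite /SA_step /SA_lyap /=.
pose eta := g t x + s; rewrite -/eta.
have e2 : vnorm eta ^+ 2 = vnorm (g t x) ^+ 2 + 2 * dotv (g t x) s + vnorm s ^+ 2.
  by rewrite /eta -[s in LHS]scale1r vnorm_sqrDZ mulr1 expr1n mul1r.
have n2 : nm (t + alpha *: eta) ^+ 2 =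
    nm t ^+ 2 + 2 * alpha * (phi t x + dotv (t - thstar) s) + alpha ^+ 2 * vnorm eta ^+ 2.
  have -> : nm (t + alpha *: eta) = vnorm ((t - thstar) + alpha *: eta).
    by rewrite /nm addrAC.
  by rewrite vnorm_sqrDZ {1}/eta dotvDr.
have h := ler_wpM2l (ltW (mulr_gt0 (ltr0n R 2) alpha0)) (corr_step x' t eta).
rewrite n2 (dotvDl (_ *: _)) !dotvZl.
apply: (le_trans (lerD (lexx _) h)); rewrite e2 /c1 le_eqVlt; apply/orP; left; apply/eqP.
by field.
Qed.

(** In units of alpha^2 tau L^2 (nm^2 + 1) the errors are 16 from moving [theta] in the correction,
    14 from the squared step (7 for [c1] times 2) and 6 from imperfect mixing. Their sum 36 costs
    alpha mu (nm^2 + 1) / 2 of the gain 2 alpha mu nm^2. What is left, 3/2 alpha mu (nm^2 + 1) up to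
    the constant 2 alpha mu, dominates alpha mu times the Lyapunov function. *)
Lemma SA_drift z : (\int[SA_ker z]_w (SA_lyap w)%:E <=
  ((1 - alpha * mu) * SA_lyap z + 2 * alpha * mu)%:E)%E.
Proof.
have lyap0 w : (0 <= (SA_lyap w)%:E)%E.
  have /andP[+ _] := SA_lyap_bounds w; rewrite lee_fin; apply: le_trans.
  by rewrite divr_ge0// addr_ge0// sqr_ge0.
have mlyap : measurable_fun setT (fun w => (SA_lyap w)%:E).
  by apply/measurable_EFinP; exact: measurable_SA_lyap.
have c10 : 0 <= c1.
  apply: addr_ge0; first exact: sqr_ge0.
  by apply: mulr_ge0 => //; apply: mulr_ge0 => //; exact: sqr_ge0.
have bcorr : bdd_meas (fun x' => SA_corr x' z.2).
  apply: bdd_meas_sum => k; apply: bdd_measB; last exact: bdd_meas_cst.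
  exact: bdd_meas_kpow.
set c0 := 1 + nm z.2 ^+ 2 + 2 * alpha * phi z.2 z.1 + c1 * vnorm (g z.2 z.1) ^+ 2 +
   16 * alpha ^+ 2 * tau%:R * L ^+ 2 * (nm z.2 ^+ 2 + 1).
pose S := (L2 * (nm z.2 + 1)) ^+ 2.
have bc : bdd_meas (fun x' => c0 + c1 * S + 2 * alpha * SA_corr x' z.2).
  by apply: bdd_measD; [exact: bdd_meas_cst|exact: bdd_measZ].
rewrite ge0_int_SA_ker//.
apply: (@le_trans _ _ (\int[P z.1]_x' (c0 + c1 * S + 2 * alpha * SA_corr x' z.2)%:E)%E).
  have inner x' : (\int[SA_noise (z, x')]_w (SA_lyap w)%:E <=
      (c0 + c1 * S + 2 * alpha * SA_corr x' z.2)%:E)%E.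
    rewrite ge0_int_SA_noise// addrAC.
    apply: le_trans (noise_quadratic_le (pkerT zeta z.2) (zeta0 z.2) (zeta2 z.2) _
      ((2 * alpha) *: ((z.2 : 'rV[R]_n) - thstar) + (2 * c1) *: g z.2 z.1) c10).
    apply: ge0_le_integral => //.
    - apply: (measurableT_comp mlyap (g := fun s => SA_step ((z, x'), s))).
      exact: measurableT_comp measurable_SA_step (pair1_measurable (z, x')).
    - apply/measurable_EFinP; apply: measurable_funD; last first.
        by apply: measurable_funM => //; exact: measurable_vnorm2.
      apply: measurable_funD => //; apply: measurable_dotv => // i; exact: measurable_coord.
    - by move=> s _; rewrite lee_fin; exact: lyap_step.
  apply: ge0_le_integral => //.
  - by move=> x' _; apply: integral_ge0.
  - exact: (measurable_fun_integral_kernel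
      (measurable_kernel (kpullback SA_noise (pair1_measurable z))) lyap0 mlyap).
  - by apply/measurable_EFinP; case: bc.
rewrite (bdd_integralE (pkerT P z.1))// lee_fin (bdd_intD (pkerT P z.1));
  [|exact: bdd_meas_cst|exact: bdd_measZ].
rewrite (prob_int_cst (pkerT P z.1)) (bdd_intZ (pkerT P z.1))// SA_corr_step.
have a0 : 0 <= nm z.2 by exact: vnorm_ge0.
have mean := SA_mean_phi z.2.
(* Total variation error alpha at time [tau], times twice the bound L1 nm (nm + 1) on phi. *)
have mix : \int[kpow P tau z.1]_y phi z.2 y <=
    \int[pi]_y phi z.2 y + 3 * alpha * L ^+ 2 * tau%:R * (nm z.2 ^+ 2 + 1).
  have [mphi _] := bdd_phi z.2.
  have := @bdd_int_tv_dist _ _ _ (kpow P tau z.1) pi alpha _ (phi z.2)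
    (pkerT _ _) pi1 _ mphi (phiB z.2).
  move=> /(_ _)/wrap[A mA|].
    have : (`|kpow P tau z.1 A - (pi : {measure set X -> \bar R}) A| <= alpha%:E)%E.
      by have := tauP z.1 mA; rewrite kiterE.
    have e1 := prob_finE (pkerT (kpow P tau) z.1) mA; have e2 := prob_finE pi1 mA.
    by rewrite e1 e2.
  rewrite ler_norml => /andP[_]; rewrite lerBlDl => /le_trans; apply; rewrite lerD2l.
  have h3 : L1 * (nm z.2 * (nm z.2 + 1)) <= (L ^+ 2 * tau%:R) * (3 / 2 * (nm z.2 ^+ 2 + 1)).
    apply: ler_pM; [exact: ltW|by rewrite mulr_ge0// addr_ge0| |].
      have LL1 : L1 <= L by rewrite /L lerDl.
      have LL : L <= L ^+ 2 by rewrite expr2 ler_peMr// (le_trans ler01).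
      by rewrite (le_trans LL1)// (le_trans LL)// ler_peMr// sqr_ge0.
    by have := sqr_ge0 (nm z.2 - 1); lra.
  by have := ler_wpM2l (ltW (mulr_gt0 (ltr0n R 2) alpha0)) h3; lra.
have gn : vnorm (g z.2 z.1) ^+ 2 + S <= 2 * L ^+ 2 * (nm z.2 ^+ 2 + 1).
  have h1 : vnorm (g z.2 z.1) ^+ 2 <= (L1 * (nm z.2 + 1)) ^+ 2.
    by rewrite lerXn2r ?nnegrE ?vnorm_ge0//; apply: mulr_ge0; [exact: ltW|exact: addr_ge0].
  have h2 : (L1 ^+ 2 + L2 ^+ 2) * (nm z.2 + 1) ^+ 2 <= L ^+ 2 * (2 * (nm z.2 ^+ 2 + 1)).
    apply: ler_pM; rewrite ?addr_ge0 ?sqr_ge0//.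
      by have := mulr_ge0 (ltW L10) L20; rewrite /L; lra.
    by have := sqr_ge0 (nm z.2 - 1); lra.
  by rewrite /S; move: h1; rewrite !exprMn; lra.
have stp : alpha * tau%:R * L ^+ 2 <= mu / 72 by rewrite ltW// step.
have /andP[_ lyb] := SA_lyap_bounds z.
have c1b : c1 <= 7 * alpha ^+ 2 * tau%:R.
  by have := ler_wpM2l (sqr_ge0 alpha) t1; rewrite /c1; lra.
have a2 : 0 <= nm z.2 ^+ 2 + 1 by rewrite addr_ge0// sqr_ge0.
have S0 : 0 <= S by exact: sqr_ge0.
have k1 : c1 * (vnorm (g z.2 z.1) ^+ 2 + S) <=
    (7 * alpha ^+ 2 * tau%:R) * (2 * L ^+ 2 * (nm z.2 ^+ 2 + 1)).
  by apply: ler_pM => //; rewrite addr_ge0// sqr_ge0.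
have k2 := ler_wpM2l (ltW alpha0) (ler_wpM2r a2 stp).
have k3 := ler_wpM2l (ltW (mulr_gt0 (ltr0n R 2) alpha0)) mix.
have k4 := ler_wpM2l (ltW (mulr_gt0 (ltr0n R 2) alpha0)) mean.
have k5 := ler_wpM2l (ltW (mulr_gt0 alpha0 mu0)) lyb.
move: k1 k2 k3 k4 k5; rewrite /c0 /SA_lyap.
by lra.
Qed.

End drift.
End SA_chain.

(** * Overlap of the transition laws *)

(* By contradiction: along a sequence of parameters violating the bound, the density
   has a positive pointwise infimum, so continuity from above applies. *)
Lemma density_lower_bound d (T : measurableType d) (R : realType) (I0 : Type)
    (leb : {measure set T -> \bar R}) (D : set T) (S : set I0) (p : I0 -> T -> R) (dl : R) :
  measurable D -> (leb D < +oo)%E -> (forall t, measurable_fun setT (p t)) ->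
  (forall s, exists2 eps : R, 0 < eps & forall t, S t -> eps <= p t s) -> 0 < dl ->
  exists2 eps : R, 0 < eps & forall t, S t ->
    (leb (D `&` [set s | (p t s < eps)%R]) <= dl%:E)%E.
Proof.
move=> mD Dfin mp pS dl0; apply: contrapT => H.
have [t tP] : {t : nat -> I0 & forall j, S (t j) /\
    (dl%:E < leb (D `&` [set s | (p (t j) s < j.+1%:R^-1)%R]))%E}.
  apply: (@choice _ _ (fun j t => S t /\ (dl%:E < leb (D `&` [set s | (p t s < j.+1%:R^-1)%R]))%E)) => j.
  apply: contrapT => Hj; apply: H; exists j.+1%:R^-1; first by rewrite invr_gt0.
  by move=> t St; rewrite leNgt; apply/negP => lt; apply: Hj; exists t.
have mlt j e : measurable [set s | p (t j) s < e].
  rewrite -[X in measurable X]setTI (_ : [set s | _] = p (t j) @^-1` `]-oo, e[%classic).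
    by apply: mp => //; exact: measurable_itv.
  by apply/seteqP; split => s /=; rewrite in_itv.
pose G k := D `&` \bigcup_j [set s | p (t j) s < k.+1%:R^-1].
have mG k : measurable (G k) by apply: measurableI => //; exact: bigcupT_measurable.
have G0 : \bigcap_k G k = set0.
  apply/seteqP; split => // s Gs; have [eps eps0 epsP] := pS s.
  have [k kP] : exists k, k.+1%:R^-1 < eps.
    exists (Num.bound eps^-1); rewrite -[ltRHS]invrK ltf_pV2 ?posrE ?invr_gt0//.
    rewrite (lt_trans (archi_boundP _)) ?invr_ge0 ?ltW// ?ltr_nat//.
  have [_ [j _ /= /lt_trans/(_ kP)]] := Gs k I.
  by rewrite ltNge epsP//; case: (tP j).
have dG : nonincreasing_seq G.
  move=> k l kl; apply/subsetPset; apply: setIS => s [j _ /= h]; exists j => //=.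
  by apply: (lt_le_trans h); rewrite lef_pV2 ?posrE// ler_nat.
have Gfin : (leb (G 0%N) < +oo)%E.
  by apply: le_lt_trans Dfin; apply: le_measure; [exact/mem_set/mG|exact/mem_set|exact: subIsetl].
have mcap : measurable (\bigcap_k G k) by rewrite G0.
have := @nonincreasing_cvg_mu _ _ _ leb G Gfin mG mcap dG; rewrite G0 measure0 => cv.
have : (dl%:E <= 0)%E.
  rewrite -(cvg_lim (@ereal_hausdorff R) cv); apply: lime_ge.
    by apply/cvg_ex; exists 0%E.
  apply: nearW => k; have [_ /ltW/le_trans] := tP k; apply.
  apply: le_measure; [exact/mem_set/measurableI|exact/mem_set/mG|].
  by apply: setIS => s /= h; exists k.
by rewrite lee_fin leNgt dl0.
Qed.

Section SA_overlap.
Context {d} {X : measurableType d} {R : realType} {n : nat}.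
Variables (P : R.-pker X ~> X) (zeta : R.-pker (@Rd R n) ~> (@Rd R n)).
Variables (g : 'rV[R]_n -> X -> 'rV[R]_n) (alpha : R).
Local Notation Z := (X * @Rd R n)%type.
Hypothesis mg : forall i, measurable_fun setT (fun z : Z => g z.2 z.1 ord0 i).
Let SA := SA_ker P zeta alpha mg.

(** States are sorted by E, the [x] from which [J] gives A at least half its mass; outside E the
    complement of A receives more than half. From [z1] the chain reaches E, from [z2] its
    complement, with probabilities close to those under [pi], which sum to 1. Each loses 1/8 to
    mixing and 1/8 to large values of [U], and the last step contributes c (1/2 - 1/4), whence c/4
    (1 - 1/2) = c/8. *)
Lemma SA_overlap (pi : probability X R) (J : R.-pker X ~> Z) (U : Z -> R)
    (k0 : nat) (c C C' : R) z1 z2 A :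
  measurable_fun setT U -> (forall z, 0 <= U z) -> 0 < C' -> 0 < c ->
  (forall z, U z <= C -> (\int[kpow SA k0 z]_w (U w)%:E <= (C' / 8)%:E)%E) ->
  (forall x B, measurable B -> `|fine (kpow P k0 x B) - fine (pi B)| <= 1 / 8) ->
  (forall z B, measurable B -> U z <= C' ->
     c * (fine (J z.1 B) - 1 / 4) <= fine (SA z B)) ->
  measurable A -> U z1 <= C -> U z2 <= C ->
  c / 8 <= fine (kpow SA k0.+1 z1 A) + fine (kpow SA k0.+1 z2 (~` A)).
Proof.
move=> mU U0 C'0 c0 UC' mix minor mA Uz1 Uz2.
have mH : measurable [set w | C' < U w].
  rewrite -[X in measurable X]setTI (_ : [set w | _] = U @^-1` `]C', +oo[%classic).
    by apply: mU => //; exact: measurable_itv.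
  by apply/seteqP; split => s /=; rewrite in_itv/= andbT.
have key z B (E : set X) : U z <= C -> measurable B -> measurable E ->
    (forall x, E x -> 1 / 2 <= fine (J x B)) ->
    c / 4 * (fine (pi E) - 1 / 4) <= fine (kpow SA k0.+1 z B).
  move=> Uz mB mE EJ.
  have bB : bdd_meas (\1_B : Z -> R) by exact: bdd_meas_indic.
  have bE : bdd_meas (\1_E : X -> R) by exact: bdd_meas_indic.
  have bH : bdd_meas (\1_[set w | C' < U w] : Z -> R) by exact: bdd_meas_indic.
  have bE' : bdd_meas (fun w : Z => \1_E w.1 : R).
    have [mf [M fM]] := bE; split; last by exists M.
    exact: measurableT_comp mf measurable_fst.
  rewrite -prob_int_indic// bdd_int_kpowS//.
  have h1 : \int[kpow SA k0 z]_w (c / 4 * (\1_E w.1 - \1_[set w | C' < U w] w)) <=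
      \int[kpow SA k0 z]_w \int[SA w]_u \1_B u.
    apply: (bdd_int_le (pkerT _ _)).
    - by apply: bdd_measZ; exact: bdd_measB.
    - exact: bdd_meas_int_kernel.
    - move=> w; rewrite prob_int_indic//.
      have F0 : 0 <= fine (SA w B) by rewrite fine_ge0.
      rewrite !indicE; have [Ew|Ew] := boolP (w.1 \in E); last first.
        rewrite (le_trans _ F0)// mulr_ge0_le0 ?divr_ge0 ?(ltW c0)//.
        by rewrite sub0r oppr_le0.
      have [Hw|Hw] := boolP (w \in [set w | C' < U w]).
        by rewrite subrr mulr0.
      have UwC : U w <= C' by rewrite leNgt; apply/negP => h; move/negP: Hw; apply; exact/mem_set.
      have := minor w B mB UwC; have := EJ w.1 (set_mem Ew).
      by rewrite subr0 mulr1; nra.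
  apply: le_trans h1; rewrite (bdd_intZ (pkerT _ _)); last exact: bdd_measB.
  rewrite ler_wpM2l ?divr_ge0 ?(ltW c0)// (bdd_intB (pkerT _ _))//.
  rewrite (SA_kpow_fst P zeta alpha mg k0 z bE) prob_int_indic//.
  have := mix z.1 E mE; rewrite ler_norml => /andP[h2 _].
  (* Markov's inequality for the event that [U] exceeds [C'] at time [k0]. *)
  have h3 : C' * \int[kpow SA k0 z]_w \1_[set w | C' < U w] w <= C' / 8.
    rewrite -(bdd_intZ (pkerT _ _))// (le_trans (ler_norm _))// -lee_fin.
    apply: le_trans (UC' z Uz); apply: (bdd_int_abs_le (pkerT _ _)) => //.
      exact: bdd_measZ.
    move=> w; rewrite indicE; have [/set_mem/= /ltW Hw|_] := boolP (w \in _).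
      by rewrite mulr1 ger0_norm// ltW.
    by rewrite mulr0 normr0.
  have h4 : \int[kpow SA k0 z]_w \1_[set w | C' < U w] w <= 1 / 8.
    by rewrite -(ler_pM2l C'0); lra.
  by lra.
pose E := [set x | 1 / 2 <= fine (J x A)].
have mE : measurable E.
  rewrite -[X in measurable X]setTI (_ : E = (fun x => fine (J x A)) @^-1` `[1 / 2, +oo[%classic).
    have mJ : measurable_fun setT (fun x => fine (J x A)).
      by apply: measurableT_comp => //; exact: measurable_kernel.
    by apply: mJ => //; exact: measurable_itv.
  by apply/seteqP; split => s /=; rewrite in_itv/= andbT.
have k1 := key z1 A E Uz1 mA mE (fun x h => h).
have prC (m : {measure set X -> \bar R}) B : m setT = 1%E -> measurable B ->
    fine (m (~` B)) = 1 - fine (m B).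
  move=> m1 mB; have -> : (m (~` B) = 1 - m B)%E.
    exact: (probability_setC (prob_of_measure m1) mB).
  by rewrite (prob_finE m1 mB) -EFinB.
have prC' (m : {measure set Z -> \bar R}) B : m setT = 1%E -> measurable B ->
    fine (m (~` B)) = 1 - fine (m B).
  move=> m1 mB; have -> : (m (~` B) = 1 - m B)%E.
    exact: (probability_setC (prob_of_measure m1) mB).
  by rewrite (prob_finE m1 mB) -EFinB.
have k2 : c / 4 * (fine (pi (~` E)) - 1 / 4) <= fine (kpow SA k0.+1 z2 (~` A)).
  apply: key => //; [exact: measurableC|exact: measurableC|].
  by move=> x /negP; rewrite -ltNge (prC' _ _ (pkerT J x) mA); lra.
have := prC (pi : {measure set X -> \bar R}) E (probability_setT _) mE => pE.
by move: k1 k2; rewrite pE; lra.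
Qed.

End SA_overlap.

(** * Lower bound for one step from bounded parameters *)

Section SA_minorization.
Context {d} {X : measurableType d} {R : realType} {n : nat}.
Variables (P : R.-pker X ~> X) (zeta : R.-pker (@Rd R n) ~> (@Rd R n)).
Variables (g : 'rV[R]_n -> X -> 'rV[R]_n) (alpha : R).
Local Notation Z := (X * @Rd R n)%type.
Hypothesis mg : forall i, measurable_fun setT (fun z : Z => g z.2 z.1 ord0 i).
Variable leb : {measure set (@Rd R n) -> \bar R}.
Hypothesis lebE : forall a b : 'rV[R]_n, (forall i, a ord0 i <= b ord0 i) ->
  leb (box a b) = (\prod_(i < n) (b ord0 i - a ord0 i))%:E.
Variable p : 'rV[R]_n -> @Rd R n -> R.
Hypothesis mp : forall t, measurable_fun setT (p t).
Hypothesis p0 : forall t s, 0 <= p t s.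
Hypothesis zeta_ge : forall t : 'rV[R]_n, forall A, measurable A ->
  (\int[leb]_(s in A) (p t s)%:E <= zeta t A)%E.
Hypothesis p_inf : forall (B : R) (s : @Rd R n), exists2 eps : R, 0 < eps &
  forall t, vnorm t <= B -> eps <= p t s.
Hypothesis alpha0 : 0 < alpha.

Definition cube (r : R) : set (@Rd R n) := box (const_mx (- r)) (const_mx r).

Let lebC r : 0 <= r -> leb (cube r) = ((2 * r) ^+ n)%:E.
Proof.
move=> r0; rewrite lebE; last by move=> i; rewrite !mxE; lra.
congr EFin; rewrite (eq_bigr (fun=> 2 * r)) ?prodr_const ?card_ord//.
by move=> i _; rewrite !mxE; lra.
Qed.

Let l0 : R := 2 ^+ n.
Let l00 : 0 < l0. Proof. by rewrite exprn_gt0. Qed.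
Let leb1 : leb (cube 1) = l0%:E. Proof. by rewrite lebC// mulr1. Qed.

Lemma cube_uniform_prob : exists m0 : probability (@Rd R n) R, forall E, measurable E ->
  leb (E `&` cube 1) = (l0 * fine (m0 E))%:E.
Proof.
have mC : measurable (cube 1) by exact: measurable_box.
(* The Dirac mass is the default of [mnormalize] for total mass zero or infinity; here the mass is
   [l0]. *)
exists (mnormalize (mrestr leb mC) (dirac (point : @Rd R n) : probability (@Rd R n) R)) => E mE.
have Efin : leb (E `&` cube 1) \is a fin_num.
  rewrite ge0_fin_numE// (le_lt_trans _ (ltry l0))// -leb1.
  by apply: le_measure; [exact/mem_set/measurableI|exact/mem_set|exact: subIsetr].
have nE (nu : {measure set (@Rd R n) -> \bar R}) (P0 : probability (@Rd R n) R) :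
    nu setT = l0%:E -> mnormalize nu P0 E = (nu E * (l0^-1)%:E)%E.
  by move=> nuT; rewrite /mnormalize nuT eqe gt_eqF.
rewrite [X in fine X](nE _ _ (_ : mrestr leb mC setT = l0%:E)); last by rewrite /mrestr setTI.
rewrite [X in (X * _)%E](_ : _ = leb (E `&` cube 1))// -(fineK Efin) -EFinM /=.
by rewrite mulrC divfK// gt_eqF.
Qed.

(* The kernel [J] draws [x'] from [P] and, independently, [theta'] uniformly from a cube; a set
   of [J]-mass above 1/4 stays charged after discarding the noise values of small density. *)
Lemma SA_minorization (thstar : 'rV[R]_n) (L1 rho : R) : 0 <= L1 ->
  (forall t x, vnorm (g t x) <= L1 * (vnorm (t - thstar) + 1)) ->
  exists (J : R.-pker X ~> Z) (c : R), 0 < c /\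
    forall z A, measurable A -> vnorm ((z.2 : 'rV[R]_n) - thstar) <= rho ->
      c * (fine (J z.1 A) - 1 / 4) <= fine (SA_ker P zeta alpha mg z A).
Proof.
move=> L10 gB; have [m0 m0E] := cube_uniform_prob.
have mf : measurable_fun setT
    (fun w : (X * X) * @Rd R n => (w.1.2, alpha *: (w.2 : 'rV[R]_n)) : Z).
  apply: measurable_fun_pair; first exact: measurableT_comp measurable_snd measurable_fst.
  apply: measurable_to_Rd => i; under eq_fun do rewrite mxE.
  apply: measurable_funM => //.
  exact: measurableT_comp (measurable_coord i) measurable_snd.
pose K2 : R.-pker (X * X)%type ~> Z :=
  pkcomp (kconst m0 : R.-pker (X * X)%type ~> (@Rd R n)) (kdirac mf).
(* For negative [rho] no state qualifies, and any kernel and constant will do. *)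
have [rho0|rho0] := ltP rho 0.
  exists (pkcomp P K2), 1; split => // z A _ h; exfalso.
  by have := le_trans (vnorm_ge0 _) h; rewrite leNgt rho0.
pose Bt := vnorm thstar + rho.
(* The noise must land in the unit cube after translation by the vector [c] introduced below, whose
   coordinates are bounded by [W - 1]; so the cube of half-side [W] contains all relevant noise
   values. *)
pose W := alpha^-1 * (Bt + alpha * (L1 * (rho + 1))) + 1.
have W1 : 1 <= W.
  rewrite /W lerDr mulr_ge0 ?invr_ge0 ?(ltW alpha0)// /Bt !addr_ge0 ?vnorm_ge0//.
  by rewrite !mulr_ge0 ?(ltW alpha0)// addr_ge0.
have mD : measurable (cube W) by exact: measurable_box.
have Dfin : (leb (cube W) < +oo)%E by rewrite lebC ?ltry// (le_trans ler01).
have [|eps eps0 epsP] := @density_lower_bound _ _ _ _ leb (cube W)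
    [set t | vnorm t <= Bt] p (l0 / 4) mD Dfin mp (p_inf Bt).
  by rewrite divr_gt0.
exists (pkcomp P K2), (eps * l0); split; first by rewrite mulr_gt0.
move=> [x t] A mA /= tr.
have tB : vnorm t <= Bt.
  rewrite /Bt -[t in leLHS](subrK thstar) addrC.
  by rewrite (le_trans (vnormD _ _))// lerD2l.
pose m := t + alpha *: g t x.
(* The new parameter equals alpha times the noise translated by [c]; the dependence on the present
   state is thus a mere translation, harmless for Lebesgue measure. *)
pose c := alpha^-1 *: m.
have cW i : `|c ord0 i| <= W - 1.
  rewrite (le_trans (coord_le_vnorm _ _))// /c vnormZ gtr0_norm ?invr_gt0// /W addrK.
  rewrite ler_wpM2l ?invr_ge0 ?(ltW alpha0)// (le_trans (vnormD _ _))// lerD//.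
  rewrite vnormZ gtr0_norm// ler_wpM2l ?(ltW alpha0)// (le_trans (gB t x))//.
  by rewrite ler_wpM2l// lerD2r.
have bA : bdd_meas (\1_A : Z -> R) by exact: bdd_meas_indic.
have mE x' : measurable [set s : @Rd R n | A (x', alpha *: (s : 'rV[R]_n))].
  have := measurableT_comp mf (pair1_measurable (x, x')).
  by move=> /(_ measurableT _ mA); rewrite setTI.
have inner x' : eps * l0 * (\int[K2 (x, x')]_w \1_A w - 1 / 4) <=
    \int[SA_noise zeta alpha mg ((x, t), x')]_w \1_A w.
  set E := [set s : @Rd R n | A (x', alpha *: (s : 'rV[R]_n))].
  have mE' : measurable E by exact: mE.
  have mtE := measurable_translate c measurableT (mE x'); rewrite setTI in mtE.
  have -> : \int[K2 (x, x')]_w \1_A w = fine (m0 E).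
    rewrite bdd_int_pkcomp//= /kconst -(prob_int_indic m0 mE').
    apply: eq_Rintegral => s _; rewrite /Rintegral /kdirac integral_dirac//.
      by rewrite diracT mul1e.
    by apply/measurable_EFinP; case: bA.
  have -> : \int[SA_noise zeta alpha mg ((x, t), x')]_w \1_A w =
      fine (zeta t (translate c @^-1` E)).
    rewrite /Rintegral ge0_int_SA_noise//=; last by apply/measurable_EFinP; case: bA.
    rewrite -(prob_int_indic (zeta t) mtE); congr fine; apply: eq_integral => s _.
    have sE : t + alpha *: (g t x + (s : 'rV[R]_n)) = alpha *: ((s : 'rV[R]_n) + c).
      rewrite !scalerDr /c scalerA mulfV ?gt_eqF// scale1r /m addrA.
      by rewrite [RHS]addrC.
    by rewrite /SA_step /= sE !indicE.
  set F := translate c @^-1` E.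
  pose G := F `&` cube W `&` [set s | eps <= p t s].
  have mS : measurable [set s | eps <= p t s].
    rewrite -[X in measurable X]setTI (_ : [set s | _] = p t @^-1` `[eps, +oo[%classic).
      by apply: mp => //; exact: measurable_itv.
    by apply/seteqP; split => s /=; rewrite in_itv/= andbT.
  have mS' : measurable [set s | p t s < eps].
    rewrite (_ : [set s | _] = ~` [set s | eps <= p t s]); first exact: measurableC.
    by apply/seteqP; split => s /=; rewrite ltNge => /negP.
  have mFW : measurable (F `&` cube W) by exact: measurableI.
  have mG : measurable G by exact: measurableI.
  have Gfin : leb G = (fine (leb G))%:E.
    rewrite fineK// ge0_fin_numE// (le_lt_trans _ Dfin)//.
    by apply: le_measure; [exact/mem_set|exact/mem_set|move=> s [[]]].
  have h1 : (eps%:E * leb G <= zeta t F)%E.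
    apply: le_trans (zeta_ge t mtE).
    apply: (@le_trans _ _ (\int[leb]_(s in G) (p t s)%:E)%E).
      rewrite -integral_cst//; apply: ge0_le_integral => //.
      - by move=> s _; rewrite lee_fin ltW.
      - by apply/measurable_EFinP; exact: measurable_funTS.
      - by move=> s [_ /=]; rewrite lee_fin.
    apply: ge0_subset_integral => //.
    - by apply/measurable_EFinP; exact: measurable_funTS.
    - by move=> s _; rewrite lee_fin.
    - by move=> s [[]].
  (* Translating the part of E in the unit cube back by [c] puts it inside the cube of half-side
     [W]; the noise values with density below [eps] there take away at most a quarter of [l0]. *)
  have h2 : ((l0 * fine (m0 E))%:E <= leb G + (l0 / 4)%:E)%E.
    rewrite -m0E//.
    have -> : leb (E `&` cube 1) = leb (translate c @^-1` (E `&` cube 1)).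
      by rewrite (leb_translate lebE)//; apply: measurableI => //; exact: measurable_box.
    apply: (@le_trans _ _ (leb (F `&` cube W))).
      apply: le_measure; [|exact/mem_set|].
        apply/mem_set; rewrite -[X in measurable X]setTI; apply: measurable_translate => //.
        by apply: measurableI => //; exact: measurable_box.
      move=> s [Es Cs]; split => // i; have := Cs i; have := cW i.
      by rewrite /translate !mxE ler_norml => /andP[? ?] /andP[? ?]; apply/andP; split; lra.
    apply: le_trans (leeD2l (leb G) (epsP t tB)).
    rewrite -measureU//; last 2 first.
    + exact: measurableI.
    + by apply/seteqP; split => // s [[_ /= h] [_ /=]]; rewrite ltNge h.
    apply: le_measure; [exact/mem_set|apply/mem_set/measurableU => //; exact: measurableI|].
    move=> s [Fs Ws]; have [h|h] := leP eps (p t s); first by left.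
    by right.
  move: h1 h2; rewrite Gfin (prob_finE (pkerT zeta t) mtE) prob_int_indic//.
  rewrite -EFinM -EFinD !lee_fin => h1 h2.
  have := ler_wpM2l (ltW eps0) h2; lra.
have e1 : fine (pkcomp P K2 x A) = \int[P x]_x' \int[K2 (x, x')]_w \1_A w.
  by rewrite -prob_int_indic// bdd_int_pkcomp.
have e2 : fine (SA_ker P zeta alpha mg (x, t) A) =
    \int[P x]_x' \int[SA_noise zeta alpha mg ((x, t), x')]_w \1_A w.
  rewrite -(prob_int_indic (SA_ker P zeta alpha mg (x, t)) mA).
  exact: (bdd_int_pkcomp (kpullback P measurable_fst) (SA_noise zeta alpha mg) ((x, t) : Z) bA).
rewrite e1 e2.
have b1 : bdd_meas (fun x' => \int[K2 (x, x')]_w \1_A w).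
  exact: (bdd_meas_int_kernel (kpullback K2 (pair1_measurable x)) bA).
have b2 : bdd_meas (fun x' => \int[SA_noise zeta alpha mg ((x, t), x')]_w \1_A w).
  exact: (bdd_meas_int_kernel
    (kpullback (SA_noise zeta alpha mg) (pair1_measurable ((x, t) : Z))) bA).
have b3 : bdd_meas (fun x' => \int[K2 (x, x')]_w \1_A w - 1 / 4).
  by apply: bdd_measB => //; exact: bdd_meas_cst.
apply: le_trans (bdd_int_le (pkerT P x) (bdd_measZ (eps * l0) b3) b2 inner).
rewrite (bdd_intZ (pkerT P x))// (bdd_intB (pkerT P x))//; last exact: bdd_meas_cst.
by rewrite (prob_int_cst (pkerT P x)).
Qed.

End SA_minorization.

(** * Ergodicity of the unprojected iteration *)

Unset Implicit Arguments.

Theorem theorem4p3 (R : realType) :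
  exists c2 : R, 0 < c2 /\
  forall (d : measure_display) (X : measurableType d) (n : nat)
    (P : R.-pker X ~> X) (pi : probability X R) (r R0 : R)
    (g : 'rV[R]_n -> X -> 'rV[R]_n) (zeta : R.-pker (Rd n) ~> (Rd n))
    (thstar : 'rV[R]_n) (mu L1 L2 M : R) (m : nat)
    (leb : {measure set (Rd n) -> \bar R}) (alpha : R) (tau : nat),
  (* pi is a stationary distribution of P *)
  stationary (fun x A => P x A) pi ->
  (* (A1): uniform geometric mixing *)
  0 <= r < 1 -> 0 < R0 ->
  (forall k x A, measurable A ->
     (`| kiter (fun x A => P x A) k x A - pi A | <= (R0 * r ^+ k)%:E)%E) ->
  (* tau = tau_alpha, the alpha-mixing time *)
  (1 <= tau)%N ->
  (forall x A, measurable A ->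
     (`| kiter (fun x A => P x A) tau x A - pi A | <= alpha%:E)%E) ->
  (forall k, (1 <= k)%N ->
     (forall x A, measurable A ->
        (`| kiter (fun x A => P x A) k x A - pi A | <= alpha%:E)%E) ->
     (tau <= k)%N) ->
  (* (A2) *)
  (forall i, measurable_fun setT (fun z : X * Rd n => g z.2 z.1 ord0 i)) ->
  (forall x, C3 (g ^~ x)) ->
  (forall x, exists B : R, forall t h1 h2 h3,
     [/\ vnorm ('D_h1 (g ^~ x) t) <= B * vnorm h1,
         vnorm ('D_h2 ('D_h1 (g ^~ x)) t) <= B * vnorm h1 * vnorm h2 &
         vnorm ('D_h3 ('D_h2 ('D_h1 (g ^~ x))) t)
           <= B * vnorm h1 * vnorm h2 * vnorm h3]) ->
  0 < L1 ->
  (forall x t t', vnorm (g t x - g t' x) <= L1 * vnorm (t - t')) ->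
  (forall x t t' h, vnorm ('D_h (g ^~ x) t - 'D_h (g ^~ x) t')
     <= L1 * vnorm (t - t') * vnorm h) ->
  (forall x t t' h1 h2,
     vnorm ('D_h2 ('D_h1 (g ^~ x)) t - 'D_h2 ('D_h1 (g ^~ x)) t')
     <= L1 * vnorm (t - t') * vnorm h1 * vnorm h2) ->
  (forall x, vnorm (g 0 x) <= L1) ->
  (forall t x, vnorm (g t x) <= L1 * (vnorm (t - thstar) + 1)) ->
  (* (A3) *)
  0 < mu ->
  (forall t t', dotv (t - t') (gbar pi g t - gbar pi g t')
     <= - mu * vnorm (t - t') ^+ 2) ->
  gbar pi g thstar = 0 ->
  (forall t, gbar pi g t = 0 -> t = thstar) ->
  mu <= 1 - r ->
  (* (A4) with p = 1 *)
  (forall (t : 'rV[R]_n) (i : 'I_n),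
     (\int[zeta t]_s ((s : 'rV[R]_n) ord0 i)%:E = 0)%E) ->
  0 <= L2 ->
  (forall t : 'rV[R]_n, (\int[zeta t]_s (vnorm (s : 'rV[R]_n) ^+ 2)%:E
     <= ((L2 * (vnorm (t - thstar) + 1)) ^+ 2)%:E)%E) ->
  twice_diff (noise_cov (fun t A => zeta t A)) ->
  (forall t h, frob ('D_h (noise_cov (fun t A => zeta t A)) t)
     <= M * (1 + vnorm (t - thstar) ^+ m) * vnorm h) ->
  (forall t h1 h2,
     frob ('D_h2 ('D_h1 (noise_cov (fun t A => zeta t A))) t)
     <= M * (1 + vnorm (t - thstar) ^+ m) * vnorm h1 * vnorm h2) ->
  1 <= L1 + L2 ->
  (* leb is the Lebesgue measure on R^n (value on closed boxes) *)
  (forall a b : 'rV[R]_n, (forall i, a ord0 i <= b ord0 i) ->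
     leb [set v : Rd n | forall i, a ord0 i <= (v : 'rV[R]_n) ord0 i <= b ord0 i]
       = (\prod_(i < n) (b ord0 i - a ord0 i))%:E) ->
  (* (A5) noise minorization *)
  (exists p : 'rV[R]_n -> Rd n -> R,
     [/\ (forall t, measurable_fun setT (p t)),
         (forall t s, 0 <= p t s),
         (forall t : 'rV[R]_n, exists zeta2 : {measure set (Rd n) -> \bar R},
            forall A, measurable A ->
              zeta t A = (\int[leb]_(s in A) (p t s)%:E + zeta2 A)%E) &
         (forall (B : R) (s : Rd n), exists eps : R, 0 < eps /\
            forall t, vnorm t <= B -> eps <= p t s)]) ->
  (* stepsize condition *)
  0 < alpha ->
  alpha * tau%:R * (L1 + L2) ^+ 2 < c2 * mu ->
  (* conclusion *)
  let Q := SA_kernel (fun x A => P x A) (fun t A => zeta t A) g alpha in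
  let V := fun z : X * Rd n => vnorm ((z.2 : 'rV[R]_n) - thstar) ^+ 2 + 1 in
  exists nubar : probability (X * Rd n)%type R,
    [/\ stationary Q nubar,
        (\int[nubar]_z (vnorm (z.2 : 'rV[R]_n) ^+ 2)%:E < +oo)%E,
        (forall nu' : probability (X * Rd n)%type R, stationary Q nu' ->
           forall A, measurable A -> nu' A = nubar A) &
        exists rho kappa : R, [/\ 0 < rho < 1, 0 < kappa &
          forall (z : X * Rd n) (k : nat),
            (Vnorm V (kiter Q k z) nubar <= (kappa * V z * rho ^+ k)%:E)%E]].
Proof.
exists (1 / 72); split; first by rewrite divr_gt0.
move=> d X n P pi r R0 g zeta thstar mu L1 L2 M m leb alpha tau _ /andP[r0 r1] R00 mixP.
move=> tau1 tauP _ mg _ _ L10 gL _ _ _ gB mu0 gmono gstar _ mur zeta0 L20 zeta2 _ _ _ L1L2 lebE.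
move=> [p [mp p0 pz p_inf]] alpha0 step Q V.
have mu1 : mu <= 1 by lra.
have step' : alpha * tau%:R * (L1 + L2) ^+ 2 < mu / 72 by lra.
pose SA := SA_ker P zeta alpha mg.
pose U := SA_lyap P g alpha pi thstar tau.
have QE : Q = fun z A => SA z A by exact: SA_kernelE.
have mU : measurable_fun setT U.
  exact: (measurable_SA_lyap P alpha mg pi tau gB).
have Ub z : V z / 2 <= U z <= 3 / 2 * V z.
  exact: (SA_lyap_bounds P mg pi alpha0 L10 gB mu1 L20 L1L2 step' z).
have V1 z : 1 <= V z by rewrite /V lerDr sqr_ge0.
have U0 z : 0 <= U z by have /andP[h _] := Ub z; have := V1 z; lra.
have drift z : (\int[SA z]_w (U w)%:E <= ((1 - alpha * mu) * U z + 2 * alpha * mu)%:E)%E.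
  exact: (SA_drift mg alpha0 tau1 tauP L10 gL gB mu0 gmono gstar mu1 zeta0 L20 zeta2 L1L2 step').
have am0 : 0 < alpha * mu by rewrite mulr_gt0.
(* Needed for the drift factor 1 - alpha mu to be nonnegative; as tau and L are at least 1, the
   stepsize condition already forces alpha <= 1. *)
have am1 : alpha * mu <= 1.
  have t1 : 1 <= tau%:R :> R by rewrite ler1n.
  have L1' : 1 <= (L1 + L2) ^+ 2 by rewrite exprn_ege1.
  have h1 : alpha <= alpha * tau%:R * (L1 + L2) ^+ 2.
    by rewrite -mulrA ler_peMr ?(ltW alpha0)// -[leLHS]mulr1 ler_pM.
  have h2 : alpha <= 1 by lra.
  by rewrite -[leRHS]mulr1 ler_pM// ltW.
have g01 : 0 <= 1 - alpha * mu < 1 by apply/andP; split; lra.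
have K0 : 0 <= 2 * alpha * mu by rewrite -mulrA mulr_ge0// ltW.
(* The asymptotic level of the drift does not depend on alpha. *)
have KE : 2 * alpha * mu / (1 - (1 - alpha * mu)) = 2.
  by rewrite subKr -[2 * alpha * mu]mulrA mulfK// gt_eqF.
have [k0 k0P] : exists k, R0 * r ^+ k <= 1 / 8.
  have cv : R0 * r ^+ k @[k --> \oo] --> 0 by apply: cvg_geometric; rewrite ger0_norm.
  have e8 : 0 < 1 / 8 :> R by rewrite divr_gt0.
  have /cvgrPdist_lt/(_ _ e8)[k _ kP] := cv.
  exists k; have := kP k (leqnn k); rewrite sub0r normrN => /ltW; apply: le_trans.
  exact: ler_norm.
have mix x B : measurable B -> `|fine (kpow P k0 x B) - fine ((pi : {measure set X -> \bar R}) B)| <= 1 / 8.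
  move=> mB; apply: le_trans k0P.
  have : (`|kpow P k0 x B - (pi : {measure set X -> \bar R}) B| <= (R0 * r ^+ k0)%:E)%E.
    by have := mixP k0 x B mB; rewrite kiterE.
  have e1 := prob_finE (pkerT (kpow P k0) x) mB.
  have e2 := prob_finE (probability_setT pi : (pi : {measure set X -> \bar R}) setT = 1%E) mB.
  by rewrite e1 e2.
have zeta_ge (t : 'rV[R]_n) A : measurable A -> (\int[leb]_(s in A) (p t s)%:E <= zeta t A)%E.
  by move=> mA; have [z2 ->//] := pz t; rewrite leeDl.
have p_inf' (B : R) (s : @Rd R n) : exists2 eps : R, 0 < eps &
    forall t, vnorm t <= B -> eps <= p t s.
  by have [eps [? ?]] := p_inf B s; exists eps.
have overlap C : exists N e, [/\ (0 < N)%N, 0 < e &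
    forall z1 z2 A, measurable A -> U z1 <= C -> U z2 <= C ->
    e <= fine (kpow SA N z1 A) + fine (kpow SA N z2 (~` A))].
  (* From [U z <= C] the mean of [U] at any later time is at most |C| + 2, so that Markov's
     inequality leaves probability 1/8 above [C']. *)
  pose C' := 8 * (`|C| + 2).
  have C'0 : 0 < C' by rewrite mulr_gt0// ltr_wpDl.
  have [J [c [c0 minor]]] := SA_minorization P mg lebE mp p0 zeta_ge p_inf' alpha0
    (2 * C' + 1) (ltW L10) gB.
  exists k0.+1, (c / 8); split => //; first by rewrite divr_gt0.
  move=> z1 z2 A mA Uz1 Uz2.
  apply: (SA_overlap (pi := pi) (J := J) (U := U) (C := C) (C' := C')) => //.
  - move=> z UzC; apply: (le_trans (drift_kpow mU U0 g01 K0 drift k0 z)).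
    rewrite lee_fin KE /C' [leRHS]mulrC mulKf// lerD2r.
    rewrite (le_trans _ (ler_norm _))//; apply: le_trans UzC.
    by rewrite ler_piMl// exprn_ile1//; lra.
  - move=> z B mB UzC; apply: minor => //.
    have /andP[h _] := Ub z; rewrite /V in h.
    have := sqr_ge0 (vnorm ((z.2 : 'rV[R]_n) - thstar) - 1).
    by move: (vnorm _) h => a h h'; nra.
have [nubar [st Ufin uniq [rho [kappa [r01 kp0 conv]]]]] := Harris mU U0 g01 K0 drift overlap.
rewrite QE; exists nubar; split => //.
- have [c cE] : exists c : R, (\int[nubar]_z (U z)%:E <= c%:E)%E.
    exists (fine (\int[nubar]_z (U z)%:E)%E); rewrite fineK// ge0_fin_numE//.
    by apply: integral_ge0 => z _; rewrite lee_fin.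
  (* The squared norm of [theta] is at most twice that of theta - thstar plus twice that of
     [thstar], and the former is at most [4 * U] because [V <= 2 * U]. *)
  pose a := 2 * vnorm thstar ^+ 2.
  have a0 : 0 <= a by rewrite mulr_ge0// sqr_ge0.
  apply: (@le_lt_trans _ _ (a + 4 * c)%:E); last by rewrite ltry.
  apply: le_trans (prob_int_affine_le (probability_setT nubar) mU U0 a0 (ler0n R 4) cE).
  apply: ge0_le_integral => //.
  + by move=> z _; rewrite lee_fin sqr_ge0.
  + apply/measurable_EFinP.
    exact: measurableT_comp (@measurable_vnorm2 R n) measurable_snd.
  + by apply/measurable_EFinP/measurable_funD => //; exact: measurable_funM.
  + move=> z _; rewrite lee_fin /a; have /andP[h _] := Ub z; rewrite /V in h.
    have h2 : vnorm (z.2 : 'rV[R]_n) <= vnorm ((z.2 : 'rV[R]_n) - thstar) + vnorm thstar.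
      by rewrite (le_trans _ (vnormD _ _))// subrK.
    have h3 := vnorm_ge0 (z.2 : 'rV[R]_n).
    move: (vnorm _) (vnorm _) (vnorm _) (U z) h h2 h3 => x1 x2 x3 u h h2 h3.
    have := sqr_ge0 (x1 - x3); nra.
(* A function dominated by [V] is halved to be dominated by [U]; undoing this costs 2, and
   [1 + U z <= 5 / 2 * V z] gives the rest. *)
- exists rho, (5 * kappa); split => //; first by rewrite mulr_gt0.
  move=> z k; rewrite kiterE; apply: Vnorm_le.
  + exact: pkerT.
  + exact: probability_setT.
  + by move=> w; rewrite (le_trans ler01).
  move=> f bf fV.
  have bf2 : bdd_meas (fun w => 2^-1 * f w) by exact: bdd_measZ.
  have := conv z k _ bf2 _; rewrite (bdd_intZ (pkerT _ _))// (bdd_intZ (probability_setT nubar))//.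
  move=> /(_ _)/wrap[w|].
    rewrite normrM ger0_norm//; have := fV w; have /andP[h _] := Ub w; lra.
  rewrite ler_norml => /andP[_ h].
  have /andP[_ h2] := Ub z; have h3 := V1 z.
  have kr : 0 <= kappa * rho ^+ k.
    by rewrite mulr_ge0 ?exprn_ge0// ltW//; case/andP: r01.
  have h4 := ler_wpM2l kr (_ : 1 + U z <= 5 / 2 * V z).
  have : kappa * rho ^+ k * (1 + U z) <= kappa * rho ^+ k * (5 / 2 * V z).
    by apply: h4; lra.
  by lra.
Qed.
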